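(* Let $\alpha\in(0,2]$, let $\gamma_\alpha$ be a (non-degenerate) strictly $\alpha$-stable distribution on $\mathbb{R}^n$, and let $\lambda$ be a probability measure on $[0,\infty)$ with $\lambda\ne\delta_0$. Then the following conditions are equivalent: 1. $\lambda$ is $\gamma_\alpha$-weakly strictly stable; 2. $\lambda=\mathcal{L}(a\,\theta_p^{1/\alpha})$ for some $a>0$ and $p\in(0,1]$, where $\theta_p$ is a positive random variable with Laplace transform $\mathbf{E}e^{-t\theta_p}=e^{-t^p}$, $t\ge0$, if $p\in(0,1)$, and $\theta_1\equiv1$; 3. $\gamma_\alpha\circ\lambda=T_a\gamma_{\alpha p}$ for some (non-degenerate) strictly $\alpha p$-stable distribution $\gamma_{\alpha p}$ on $\mathbb{R}^n$ and some numbers $a>0$ and $p\in(0,1]$.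
   Context: $\mathcal{L}(\theta)$ denotes the distribution of $\theta$. For a probability measure $\nu$ on $\mathbb{R}^n$ (or $\mathbb{R}$) and $t\ge0$, $T_t\nu$ is the distribution of $tY$, where $Y\sim\nu$. For a probability measure $\mu$ on $\mathbb{R}^n$ and a probability measure $\lambda$ on $[0,\infty)$, $\mu\circ\lambda=\int_{[0,\infty)}T_t\mu\,\lambda(dt)$ is the scale mixture, i.e. the distribution of $\mathbf{X}\theta$ with $\mathbf{X}\sim\mu$ and $\theta\sim\lambda$ independent. A probability measure $\nu$ on $\mathbb{R}^n$ is strictly $\alpha$-stable if $T_r\nu*T_s\nu=T_{(r^\alpha+s^\alpha)^{1/\alpha}}\nu$ for all $r,s>0$; non-degenerate means that it is not a point mass. A probability measure $\lambda$ on $[0,\infty)$ is called $\gamma_\alpha$-weakly strictly stable (strictly stable with respect to the weak generalized convolution defined by $\gamma_\alpha$) if for all $r,s\ge0$ there exists $c(r,s)\ge0$ such that $(\gamma_\alpha\circ T_r\lambda)*(\gamma_\alpha\circ T_s\lambda)=\gamma_\alpha\circ T_{c(r,s)}\lambda$. *)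

(* Defs.v *)
From HB Require Import structures.
From mathcomp Require Import all_boot all_order all_algebra.
From mathcomp Require Import all_classical all_reals all_analysis measurable_realfun giry.

Set Implicit Arguments.
Unset Strict Implicit.
Unset Printing Implicit Defensive.

Import Order.TTheory GRing.Theory Num.Theory.
Import numFieldNormedType.Exports.

Local Open Scope classical_set_scope.
Local Open Scope ring_scope.

(* 'rV[R]_n carries its Borel sigma-algebra; measurable_coord and
   measurable_fun_rV give the usual reduction to coordinates. *)
HB.instance Definition _ (R : realType) (n : nat) := @isMeasurable.Build
  (sigma_display (@open 'rV[R]_n)) 'rV[R]_n <<s @open 'rV[R]_n >>
  (@sigma_algebra0 _ setT (@open 'rV[R]_n))
  (@sigma_algebraC _ (@open 'rV[R]_n))
  (@sigma_algebra_bigcup _ setT (@open 'rV[R]_n)).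

Section borel_rV.
Context (R : realType) (n : nat).

Lemma measurable_coord (i : 'I_n) :
  measurable_fun [set: 'rV[R]_n] (fun x : 'rV[R]_n => x ord0 i).
Proof.
apply: (measurability _ (RGenOpens.measurableE R)) => _ [_ [r [s ->]] <-].
rewrite setTI; apply: sub_sigma_algebra.
apply: open_comp; first by move=> x _; exact: coord_continuous.
exact: interval_open.
Qed.

Let box (q : 'rV[rat]_n * nat) : set 'rV[R]_n :=
  [set x | forall i, ball (ratr (q.1 ord0 i) : R) q.2.+1%:R^-1 (x ord0 i)].

Let open_boxes (U : set 'rV[R]_n) : open U ->
  U = \bigcup_q (if `[< box q `<=` U >] then box q else set0).
Proof.
move=> oU; apply/seteqP; split => [x Ux|x [q _]]; last by case: asboolP => // h /h.
have /nbhs_ballP[e /= e0 xU] := open_nbhs_nbhs (conj oU Ux).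
have [k ke] : exists k : nat, k.+1%:R^-1 < e / 2.
  exists (Num.truncn (e / 2)^-1); rewrite invf_plt ?posrE ?divr_gt0//.
  exact: truncnS_gt.
have k0 : 0 < k.+1%:R^-1 :> R by rewrite invr_gt0.
have qP i : exists q : rat, ball (ratr q : R) k.+1%:R^-1 (x ord0 i).
  have /rat_in_itvoo[q] : x ord0 i < x ord0 i + k.+1%:R^-1 by rewrite ltrDl.
  rewrite in_itv/= => /andP[h1 h2]; exists q.
  rewrite /ball/= ger0_norm ?subr_ge0 1?ltW//.
  by rewrite ltrBlDl.
pose q := \row_i sval (cid (qP i)).
exists (q, k) => //; case: asboolP => [_ i|[]]/=.
  by rewrite mxE; exact: svalP (cid (qP i)).
move=> y yq; apply: xU; split => // i j; rewrite (ord1 i).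
have := yq j; have := svalP (cid (qP j)); rewrite /= mxE.
set r := ratr _ => xr ry; apply: (le_ball _ (ball_triangle (ball_sym xr) ry)).
by rewrite [leRHS]splitr lerD// ltW.
Qed.

Lemma measurable_fun_rV d (T : measurableType d) (f : T -> 'rV[R]_n) :
  (forall i, measurable_fun setT (fun x => f x ord0 i)) ->
  measurable_fun setT f.
Proof.
move=> mf; apply: (measurability (@open 'rV[R]_n)) => // _ [U oU <-].
rewrite setTI (open_boxes oU) preimage_bigcup.
apply: countable_bigcupT_measurable => // q.
case: ifP => _; last by rewrite preimage_set0.
rewrite (_ : f @^-1` _ = \bigcap_(i in [set: 'I_n])
  ((fun x => f x ord0 i) @^-1` ball (ratr (q.1 ord0 i) : R) q.2.+1%:R^-1)).
  apply: fin_bigcap_measurable => // i _.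
  rewrite -[X in measurable X]setTI; apply: mf => //.
  exact: measurable_ball.
by apply/seteqP; split => x /= h i; [move=> _|]; exact: h.
Qed.

End borel_rV.

Section operations.
Context (R : realType) (n : nat).

Definition scale_real (t x : R) : R := t * x.

Definition scale_vec (t : R) (x : 'rV[R]_n) : 'rV[R]_n := t *: x.

Definition scale_pair (u : R * 'rV[R]_n) : 'rV[R]_n := u.1 *: u.2.

Definition add_pair (u : 'rV[R]_n * 'rV[R]_n) : 'rV[R]_n := u.1 + u.2.

Definition scale_powR (a b x : R) : R := a * x `^ b.

Let measurable_scale_real t : measurable_fun setT (scale_real t).
Proof. exact: measurable_funM. Qed.

Let measurable_scale_vec t : measurable_fun setT (scale_vec t).
Proof.
apply: measurable_fun_rV => i; under eq_fun do rewrite mxE.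
by apply: measurable_funM => //; exact: measurable_coord.
Qed.

Let measurable_scale_pair : measurable_fun setT scale_pair.
Proof.
apply: measurable_fun_rV => i; under eq_fun do rewrite mxE.
apply: measurable_funM; first exact: measurable_fst.
exact: measurableT_comp (measurable_coord i) measurable_snd.
Qed.

Let measurable_add_pair : measurable_fun setT add_pair.
Proof.
apply: measurable_fun_rV => i; under eq_fun do rewrite mxE.
apply: measurable_funD; apply: (measurableT_comp (measurable_coord i)).
  exact: measurable_fst.
exact: measurable_snd.
Qed.

Let measurable_scale_powR a b : measurable_fun setT (scale_powR a b).
Proof. by apply: measurable_funM => //; exact: measurable_powR. Qed.

HB.instance Definition _ t :=
  isMeasurableFun.Build _ _ _ _ (scale_real t) (measurable_scale_real t).
HB.instance Definition _ t :=
  isMeasurableFun.Build _ _ _ _ (scale_vec t) (measurable_scale_vec t).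
HB.instance Definition _ :=
  isMeasurableFun.Build _ _ _ _ scale_pair measurable_scale_pair.
HB.instance Definition _ :=
  isMeasurableFun.Build _ _ _ _ add_pair measurable_add_pair.
HB.instance Definition _ a b :=
  isMeasurableFun.Build _ _ _ _ (scale_powR a b) (measurable_scale_powR a b).

Implicit Types (mu nu : probability 'rV[R]_n R) (lambda : probability R R).

Definition dilate_real (t : R) lambda : probability R R :=
  distribution lambda (scale_real t).

Definition dilate (t : R) mu : probability 'rV[R]_n R :=
  distribution mu (scale_vec t).

Definition convolve mu nu : probability 'rV[R]_n R :=
  distribution (mu \x nu)%E add_pair.

(* The law of theta X with (theta, X) distributed as the product
   lambda \x mu; see scale_mixtureE for the integral form. *)
Definition scale_mixture mu lambda : probability 'rV[R]_n R :=
  distribution (lambda \x mu)%E scale_pair.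

Lemma scale_mixtureE mu lambda (A : set 'rV[R]_n) :
  scale_mixture mu lambda A = (\int[lambda]_t dilate t mu A)%E.
Proof.
apply: eq_integral => t _; congr (mu _).
by apply/seteqP; split => x /=; rewrite /xsection /= in_setE.
Qed.

Definition degenerate mu : Prop := exists x : 'rV[R]_n, mu ≡μ \d_x.

Definition strictly_stable (alpha : R) mu : Prop :=
  forall r s : R, 0 < r -> 0 < s ->
    convolve (dilate r mu) (dilate s mu) ≡μ
    dilate ((r `^ alpha + s `^ alpha) `^ alpha^-1) mu.

Definition weakly_strictly_stable mu lambda : Prop :=
  forall r s : R, 0 <= r -> 0 <= s ->
    exists2 c : R, 0 <= c &
      convolve (scale_mixture mu (dilate_real r lambda))
               (scale_mixture mu (dilate_real s lambda)) ≡μ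
      scale_mixture mu (dilate_real c lambda).

(* theta is a version of theta_p: only its law is used, so positivity and
   theta_1 = 1 are required almost surely. *)
Definition positive_stable_rv (p : R) d (T : measurableType d)
    (P : probability T R) (theta : {RV P >-> R}) : Prop :=
  [/\ {ae P, forall w, 0 < theta w},
      p < 1 -> forall t, 0 <= t ->
        ('E_P[fun w => expR (- (t * theta w))] = (expR (- (t `^ p)))%:E)%E
    & p = 1 -> {ae P, forall w, theta w = 1}].

End operations.

Arguments positive_stable_rv {R} p {d T} P theta.

(* Main.v *)
(* Write lambda as the law of Z >= 0 and Y = Z^alpha.  Conditionally on the scales,
   strict stability merges two independent copies of gamma: the convolution of
   the mixtures with scales Z1 and Z2 is the mixture with scale
   (Z1^alpha + Z2^alpha)^(1/alpha).  A coordinate of gamma has characteristic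
   function exp(-z s^alpha), s >= 0, with Re z > 0, so the mixture of gamma
   determines the Laplace transform of Y on the ray spanned by z, hence, by the
   maximum principle in the sector around the positive axis bounded by the rays
   of z and its conjugate, on the positive axis.  Weak stability thus becomes
   L(r u) L(s u) = L(c u) for the Laplace transform L of Y, which forces
   L(u) = exp(-b u^p), with p <= 1 because 1 - L is concave.  Conversely, Laplace
   transforms determine laws on [0, +oo[ and the same merging identity shows that
   a mixture of gamma with positive p-stable scales is alpha p-stable. *)
From HB Require Import structures.
Require Import Defs.
From mathcomp Require Import all_boot all_order all_algebra.
From mathcomp Require Import all_classical all_reals all_analysis giry.
From mathcomp Require Import measurable_realfun ring lra.

Set Implicit Arguments.
Unset Strict Implicit.
Unset Printing Implicit Defensive.

Import Order.TTheory GRing.Theory Num.Theory.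
Import numFieldNormedType.Exports.

Local Open Scope classical_set_scope.
Local Open Scope ring_scope.

(** * Expectations of bounded functions *)

(** The stable law may be skewed, so [z] need not be real, and a mixture then shows the Laplace
    transform of [Y] only along a slanted ray. Leaving that ray is the obstacle that shapes the
    proof. No holomorphic function appears: only the real part of the transform is used, its
    evenness in the imaginary variable supplies the conjugate ray, and harmonicity is replaced by a
    cubic bound in the step [h] on a five-point difference, which is enough to beat a perturbation
    of order [h^2]. The sector is unbounded, but on a far vertical segment the difference of two
    transforms stays close to its value 0 on the ray.

    One coordinate suffices: if [Re z] vanished for all of them, every coordinate would be almost
    surely constant and [gamma] a point mass.

    The variable [theta_p] is never constructed beforehand: starting from weak stability, it is a
    normalised power of the identity on the line with law [lambda]. Conversely, any given version of
    it enters only through its Laplace transform and its almost sure positivity. *)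

Section bounded_expectation.
Context d (T : measurableType d) (R : realType) (P : probability T R).
Implicit Types f g : T -> R.

Lemma bounded_integrable f (M : R) : measurable_fun setT f ->
  (forall x, `|f x| <= M) -> P.-integrable setT (EFin \o f).
Proof.
move=> mf fM; apply: measurable_bounded_integrable => //.
  by rewrite -ge0_fin_numE ?fin_num_measure.
by exists M; split; [rewrite num_real|move=> N MN x _; exact: le_trans (fM x) (ltW MN)].
Qed.

Lemma RintegrableD f g : P.-integrable setT (EFin \o f) ->
  P.-integrable setT (EFin \o g) -> P.-integrable setT (EFin \o (fun x => f x + g x)).
Proof. by move=> i1 i2; have := integrableD measurableT i1 i2; exact. Qed.

Lemma RintegrableB f g : P.-integrable setT (EFin \o f) ->
  P.-integrable setT (EFin \o g) -> P.-integrable setT (EFin \o (fun x => f x - g x)).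
Proof. by move=> i1 i2; have := integrableB measurableT i1 i2; exact. Qed.

Lemma RintegrableZl f r : P.-integrable setT (EFin \o f) ->
  P.-integrable setT (EFin \o (fun x => r * f x)).
Proof. by move=> i1; have := integrableZl measurableT r i1; exact. Qed.

Lemma Rintegrable_norm f : P.-integrable setT (EFin \o f) ->
  P.-integrable setT (EFin \o (fun x => `|f x|)).
Proof. by move=> i1; have := integrable_norm i1; exact. Qed.

Lemma Rintegral_cst1 (r : R) : \int[P]_x r = r.
Proof. by rewrite Rintegral_cst//= probability_setT mulr1. Qed.

Lemma EFin_Rintegral f : P.-integrable setT (EFin \o f) ->
  ((\int[P]_x f x)%:E = \int[P]_x (f x)%:E)%E.
Proof. by move=> intf; rewrite fineK//; exact: integrable_fin_num. Qed.

Lemma cvg_Rintegral_bounded (f_ : nat -> T -> R) f (M : R) :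
  (forall n, measurable_fun setT (f_ n)) -> (forall n x, `|f_ n x| <= M) ->
  (forall x, f_ n x @[n --> \oo] --> f x) ->
  \int[P]_x f_ n x @[n --> \oo] --> \int[P]_x f x.
Proof.
move=> mf_ f_M f_f.
have mf : measurable_fun setT f.
  by apply: measurable_fun_cvg mf_ _ => x _; exact: f_f.
have fM x : `|f x| <= M.
  apply: (closed_cvg (fun y : R => `|y| <= M)) (f_f x) => //.
    apply: (@closed_comp _ _ (fun y : R => `|y|) [set y | y <= M]).
      by move=> y _; exact: norm_continuous.
    exact: closed_le.
  exact: nearW.
apply: fine_cvg; rewrite fineK; last first.
  by apply: integrable_fin_num => //; exact: bounded_integrable fM.
apply: (@dominated_cvg _ _ _ P _ measurableT (fun n x => (f_ n x)%:E) _ (cst M%:E)) => //.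
- by move=> n; exact/measurable_EFinP.
- by move=> x _; apply: cvg_EFin; [exact: nearW|exact: f_f].
- by apply: finite_measure_integrable_cst.
- by move=> n x _; rewrite /= lee_fin.
Qed.

Lemma Rintegral_eq0_ae f (M : R) : measurable_fun setT f ->
  (forall x, 0 <= f x <= M) -> \int[P]_x f x = 0 ->
  {ae P, forall x, f x = 0}.
Proof.
move=> mf f0M If0.
have fM x : `|f x| <= M by have /andP[f0 ?] := f0M x; rewrite ger0_norm.
have /(ae_eq_integral_abs P measurableT) : measurable_fun setT (EFin \o f).
  exact/measurable_EFinP.
move=> [+ _].
have -> : (\int[P]_x `|(EFin \o f) x| = 0)%E.
  rewrite -[0%E]/(0%:E) -If0 EFin_Rintegral; last exact: bounded_integrable fM.
  by apply: eq_integral => x _ /=; have /andP[f0 _] := f0M x; rewrite ger0_norm.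
move=> /(_ erefl); apply: filterS => x /= /(_ I).
by move=> [].
Qed.

End bounded_expectation.

(** Dominated convergence speaks of sequences, so joint continuity of an integral in two parameters
    is reduced to sequential continuity; the balls of radius [1/(n+1)] form a countable base. *)
Lemma seq_continuous (R : realType) (f : R * R -> R) (p : R * R) :
  (forall u : nat -> R * R, u n @[n --> \oo] --> p ->
     f (u n) @[n --> \oo] --> f p) -> {for p, continuous f}.
Proof.
move=> fu; apply/cvgrPdist_lt => e e0; apply: contrapT => nN.
have /choice[u uP] (n : nat) : exists q, ball p n.+1%:R^-1 q /\ e <= `|f p - f q|.
  apply: contrapT => /forallNP H; apply: nN.
  have n0 : 0 < n.+1%:R^-1 :> R by rewrite invr_gt0.
  apply: (filterS _ (nbhsx_ballx p _ n0)) => q pq /=.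
  by rewrite ltNge; apply/negP => h; exact: (H q).
have up : u n @[n --> \oo] --> p.
  apply/cvg_ballP => r r0; near=> n.
  apply: (@le_ball _ _ _ n.+1%:R^-1); last by have [] := uP n.
  apply/ltW; near: n; exact: near_infty_natSinv_lt (PosNum r0).
have /cvgrPdist_lt/(_ _ e0) := fu _ up.
move=> [N _ /(_ N (leqnn N))] /=.
by have [_ ] := uP N; rewrite leNgt => /negbTE ->.
Unshelve. all: by end_near. Qed.

Lemma eq_Rintegral_measure d (T : measurableType d) (R : realType)
    (P Q : probability T R) (f : T -> R) :
  P ≡μ Q -> \int[P]_x f x = \int[Q]_x f x.
Proof. by move=> PQ; congr fine; apply: eq_measure_integral => A mA _; exact: PQ. Qed.

Lemma Rintegral_distribution d d' (T : measurableType d) (T' : measurableType d')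
    (R : realType) (P : probability T R) (X : {mfun T >-> T'}) (f : T' -> R) (M : R) :
  measurable_fun setT f -> (forall y, `|f y| <= M) ->
  \int[distribution P X]_y f y = \int[P]_x f (X x).
Proof.
move=> mf fM; congr fine; rewrite integral_distribution//; first exact/measurable_EFinP.
suff : P.-integrable setT (EFin \o (f \o X)) by [].
apply: (@bounded_integrable _ _ _ P (f \o X) M); first exact: measurableT_comp.
by move=> x; exact: fM.
Qed.

Lemma ae_eq_Rintegral d (T : measurableType d) (R : realType) (P : probability T R)
    (f g : T -> R) : measurable_fun setT f -> measurable_fun setT g ->
  {ae P, forall x, f x = g x} -> \int[P]_x f x = \int[P]_x g x.
Proof.
move=> mf mg fg; congr fine; apply: ae_eq_integral => //; try exact/measurable_EFinP.
by apply: filterS fg => x /= fgx _; rewrite fgx.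
Qed.

(** Tonelli gives measurability for nonnegative integrands; adding the bound [M] makes [f] one, at
    the cost of a constant. *)
Lemma measurable_Rintegral_snd d1 d2 (T1 : measurableType d1) (T2 : measurableType d2)
    (R : realType) (P2 : probability T2 R) (f : T1 * T2 -> R) (M : R) :
  measurable_fun setT f -> (forall z, `|f z| <= M) ->
  measurable_fun setT (fun x => \int[P2]_y f (x, y)).
Proof.
move=> mf fM.
have mf' (x : T1) : measurable_fun setT (fun y => f (x, y)) by exact: measurableT_comp.
have -> : (fun x => \int[P2]_y f (x, y)) =
    (fun x => \int[P2]_y (f (x, y) + M)) \- cst M.
  apply/funext => x /=; rewrite RintegralD//.
  - by rewrite Rintegral_cst1 addrK.
  - by apply: (@bounded_integrable _ _ _ P2 (fun y => f (x, y)) M).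
  - exact: finite_measure_integrable_cst.
apply: measurable_funB => //; apply: measurableT_comp => //.
have mg : measurable_fun setT (fun z => (f z + M)%:E).
  by apply/measurable_EFinP; exact: measurable_funD.
apply: (@measurable_fun_fubini_tonelli_F _ _ _ _ _ P2 (fun z => (f z + M)%:E)) => // z.
by rewrite lee_fin -lerBlDr sub0r; have := fM z; rewrite ler_norml => /andP[].
Qed.

Section product_expectation.
Context d1 d2 (T1 : measurableType d1) (T2 : measurableType d2) (R : realType).
Variables (P1 : probability T1 R) (P2 : probability T2 R).

Lemma Rintegral_prod (f : T1 * T2 -> R) (M : R) :
  measurable_fun setT f -> (forall z, `|f z| <= M) ->
  \int[(P1 \x P2)%E]_z f z = \int[P1]_x \int[P2]_y f (x, y).
Proof.
move=> mf fM.
have intf : (P1 \x P2)%E.-integrable setT (EFin \o f) := bounded_integrable _ mf fM.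
rewrite /Rintegral -(integral12_prod_meas1 intf); congr fine.
apply: eq_integral => x _; rewrite /fubini_F -EFin_Rintegral//.
apply: (@bounded_integrable _ _ _ P2 (fun y => f (x, y)) M) => //.
exact: measurableT_comp.
Qed.

Lemma Rintegral_prodM (f : T1 -> R) (g : T2 -> R) (M : R) :
  measurable_fun setT f -> measurable_fun setT g ->
  (forall x, `|f x| <= M) -> (forall y, `|g y| <= M) ->
  \int[(P1 \x P2)%E]_z (f z.1 * g z.2) = \int[P1]_x f x * \int[P2]_y g y.
Proof.
move=> mf mg fM gM.
rewrite (@Rintegral_prod _ (M * M)).
- rewrite -RintegralZr//; last exact: bounded_integrable fM.
  apply: eq_Rintegral => x _ /=; rewrite RintegralZl//.
  exact: bounded_integrable gM.
- by apply: measurable_funM; exact: measurableT_comp.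
- by move=> z; rewrite normrM ler_pM.
Qed.

End product_expectation.

(** * Laplace transforms determine tails *)

Lemma measurable_laplace d (T : measurableType d) (R : realType) (Y : T -> R) u :
  measurable_fun setT Y -> measurable_fun setT (fun x => expR (- (u * Y x))).
Proof.
move=> mY; apply: measurableT_comp => //; apply: measurableT_comp => //.
exact: measurable_funM.
Qed.

Lemma laplace_itv (R : realType) (u y : R) : 0 <= u -> 0 <= y ->
  0 <= expR (- (u * y)) <= 1.
Proof. by move=> u0 y0; rewrite expR_ge0 expR_le1 oppr_le0 mulr_ge0. Qed.

Lemma cvg_natr_expR (R : realType) (c : R) : 0 < c ->
  n%:R * expR (- (c * n%:R)) @[n --> \oo] --> 0.
Proof.
(* From [exp x >= 1 + x^2/2] comes [n exp(-c n) <= 2/(c^2 n)], and [1/n <= 2/(n+1)] for [n >= 1]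
   turns this into a multiple of the harmonic sequence. *)
move=> c0; apply: (@squeeze_cvgr _ _ _ _ (cst 0) (fun n : nat => 2 / c ^+ 2 * n.+1%:R^-1 *+ 2)).
- near=> n; apply/andP; split; first by rewrite mulr_ge0 ?expR_ge0.
  have n0 : (0 < n)%N by near: n; exists 1%N.
  have nr : 1 <= n%:R :> R by rewrite ler1n.
  have cn0 : 0 < c * n%:R by rewrite mulr_gt0 // ltr0n.
  have := @expR_ge1Dxn R (c * n%:R) 1 (ltW cn0).
  rewrite (_ : 2`!%:R = 2 :> R)// => h; rewrite expRN -[n.+1%:R]natr1.
  have e0 := expR_gt0 (c * n%:R).
  rewrite ler_pdivrMr//.
  apply: (@le_trans _ _ ((2 / c ^+ 2 * (n%:R + 1)^-1 *+ 2) * ((c * n%:R) ^+ 2 / 2))); last first.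
    rewrite ler_wpM2l//; last by apply: le_trans h; rewrite lerDr.
    by rewrite mulrn_wge0// mulr_ge0 ?divr_ge0 ?invr_ge0 ?sqr_ge0// addr_ge0.
  have -> : (2 / c ^+ 2 * (n%:R + 1)^-1 *+ 2) * ((c * n%:R) ^+ 2 / 2) =
    n%:R * (2 * n%:R / (n%:R + 1)).
    by field; rewrite gt_eqF //= gt_eqF //; lra.
  by rewrite ler_peMr// ler_pdivlMr; lra.
- exact: cvg_cst.
- rewrite -[X in _ --> X](mul0rn _ 2); apply: cvgMn.
  rewrite -[X in _ --> X](mulr0 (2 / c ^+ 2)); apply: cvgM; first exact: cvg_cst.
  exact: cvg_harmonic.
Unshelve. all: by end_near. Qed.

Lemma bernoulli_onem (R : realType) (x : R) (k : nat) : 0 <= x <= 1 ->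
  1 - k%:R * x <= (1 - x) ^+ k.
Proof.
move=> /andP[x0 x1]; elim: k => [|k IH]; first by rewrite mul0r subr0 expr0.
rewrite exprS -[k.+1%:R]natr1.
apply: le_trans (ler_wpM2l _ IH); last by rewrite subr_ge0.
have : 0 <= k%:R * x * x by rewrite !mulr_ge0.
nra.
Qed.

(* [e^-(wY) < 1/2] iff [ln 2 / w < Y], so these functions of [e^-(wY)] converge
   to the indicator of [ln 2 / w < Y]. *)
Lemma cvg_laplace_indic (R : realType) (w y : R) : 0 <= w -> 0 <= y ->
  (1 - expR (- ((n%:R * w) * y))) ^+ (n * 2 ^ n) @[n --> \oo] -->
  ((ln 2 < w * y)%R%:R : R).
Proof.
move=> w0 y0.
have q01 n : 0 <= expR (- (n%:R * w * y)) <= 1 by rewrite laplace_itv// mulr_ge0.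
have E (n : nat) : (n * 2 ^ n)%:R * expR (- (n%:R * w * y)) =
    n%:R * expR (- ((w * y - ln 2) * n%:R)).
  rewrite natrM natrX -mulrA; congr (_ * _).
  rewrite -[X in X ^+ _](@lnK R 2) ?posrE// -expRM_natl -expRD; congr expR.
  ring.
case: ltP => h /=.
  apply: (@squeeze_cvgr _ _ _ _
    (fun n : nat => 1 - n%:R * expR (- ((w * y - ln 2) * n%:R))) (cst 1)).
  - near=> n; rewrite -E bernoulli_onem// /=.
    have /andP[? ?] := q01 n.
    by apply: exprn_ile1; rewrite ?subr_ge0// gerBl.
  - rewrite -[X in _ --> X]subr0; apply: cvgB; first exact: cvg_cst.
    by apply: cvg_natr_expR; rewrite subr_gt0.
  - exact: cvg_cst.
(* The factor [n] in the exponent settles the boundary [w * y = ln 2]: there [(1 - 2^-n)^(2^n)]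
   alone would tend to [1/e], and its [n]-th power tends to 0. *)
apply: (@squeeze_cvgr _ _ _ _ (cst 0) (fun n : nat => expR (- n%:R))).
- near=> n; have /andP[? ?] := q01 n; apply/andP; split.
    by rewrite exprn_ge0// subr_ge0.
  apply: (@le_trans _ _ (expR (- expR (- (n%:R * w * y))) ^+ (n * 2 ^ n))).
    by rewrite lerXn2r ?nnegrE ?subr_ge0 ?expR_ge0// expR_ge1Dx.
  rewrite -expRM_natl ler_expR mulrN lerN2 E ler_peMr// -[leLHS]expR0 ler_expR.
  by rewrite oppr_ge0 mulr_le0_ge0// subr_le0.
- exact: cvg_cst.
- exact: cvgn_expR.
Unshelve. all: by end_near. Qed.

Section laplace_transform.
Context (R : realType).

(** The functions approximating an indicator are polynomials in [exp(-w Y)], so their integrals are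
    combinations of Laplace values. The free exponent [v] serves the induction: one factor
    [1 - exp(-w Y)] splits the integral into one at [v] and one at [v + w]. *)
Lemma laplace_poly d1 d2 (T1 : measurableType d1) (T2 : measurableType d2)
    (P1 : probability T1 R) (P2 : probability T2 R) (Y1 : T1 -> R) (Y2 : T2 -> R)
    (v w : R) (k : nat) :
  measurable_fun setT Y1 -> measurable_fun setT Y2 ->
  (forall x, 0 <= Y1 x) -> (forall x, 0 <= Y2 x) ->
  (forall u, 0 <= u ->
    \int[P1]_x expR (- (u * Y1 x)) = \int[P2]_x expR (- (u * Y2 x))) ->
  0 <= v -> 0 <= w ->
  \int[P1]_x (expR (- (v * Y1 x)) * (1 - expR (- (w * Y1 x))) ^+ k) =
  \int[P2]_x (expR (- (v * Y2 x)) * (1 - expR (- (w * Y2 x))) ^+ k).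
Proof.
move=> mY1 mY2 Y1_ge0 Y2_ge0 L12 + w0; elim: k v => [|k IH] v v0.
  transitivity (\int[P1]_x expR (- (v * Y1 x))).
    by apply: eq_Rintegral => x _; rewrite expr0 mulr1.
  by rewrite L12//; apply: eq_Rintegral => x _; rewrite expr0 mulr1.
have split_int d (T : measurableType d) (P : probability T R) (Y : T -> R) :
    measurable_fun setT Y -> (forall x : T, 0 <= Y x) ->
    \int[P]_x (expR (- (v * Y x)) * (1 - expR (- (w * Y x))) ^+ k.+1) =
    \int[P]_x (expR (- (v * Y x)) * (1 - expR (- (w * Y x))) ^+ k) -
    \int[P]_x (expR (- ((v + w) * Y x)) * (1 - expR (- (w * Y x))) ^+ k).
  move=> mY Y0.
  have intP u : 0 <= u -> P.-integrable setT
      (EFin \o (fun x => expR (- (u * Y x)) * (1 - expR (- (w * Y x))) ^+ k)).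
    move=> u0; apply: (@bounded_integrable _ _ _ P _ 1).
      apply: measurable_funM; first exact: measurable_laplace.
      apply: measurable_funX; apply: measurable_funB => //.
      exact: measurable_laplace.
    move=> x; have /andP[? ?] := laplace_itv u0 (Y0 x).
    have /andP[? ?] := laplace_itv w0 (Y0 x).
    rewrite normrM ger0_norm// ger0_norm ?exprn_ge0 ?subr_ge0//.
    by rewrite mulr_ile1// ?exprn_ge0 ?subr_ge0// exprn_ile1 ?subr_ge0// gerBl.
  rewrite -RintegralB//; [|exact: intP|by apply: intP; rewrite addr_ge0].
  apply: eq_Rintegral => x _; rewrite mulrDl opprD expRD exprS.
  by rewrite mulrBl mul1r mulrBr mulrA.
rewrite (split_int _ _ P1 Y1 mY1 Y1_ge0) (split_int _ _ P2 Y2 mY2 Y2_ge0).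
by congr (_ - _); apply: IH => //; exact: addr_ge0.
Qed.

Lemma laplace_tail d1 d2 (T1 : measurableType d1) (T2 : measurableType d2)
    (P1 : probability T1 R) (P2 : probability T2 R) (Y1 : T1 -> R) (Y2 : T2 -> R) :
  measurable_fun setT Y1 -> measurable_fun setT Y2 ->
  (forall x, 0 <= Y1 x) -> (forall x, 0 <= Y2 x) ->
  (forall u, 0 <= u ->
    \int[P1]_x expR (- (u * Y1 x)) = \int[P2]_x expR (- (u * Y2 x))) ->
  forall y, 0 < y -> P1 (Y1 @^-1` `]y, +oo[) = P2 (Y2 @^-1` `]y, +oo[).
Proof.
move=> mY1 mY2 Y1_ge0 Y2_ge0 L12 y y0.
(* This choice moves the threshold [ln 2 < w * Y] to [y < Y]. *)
pose w := ln 2 / y.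
have w0 : 0 <= w by rewrite divr_ge0 ?ln_ge0 ?ltW// ltr1n.
have lim d (T : measurableType d) (P : probability T R) (Y : T -> R) :
    measurable_fun setT Y -> (forall x : T, 0 <= Y x) ->
    \int[P]_x (expR (- (0 * Y x)) * (1 - expR (- ((n%:R * w) * Y x))) ^+ (n * 2 ^ n))
      @[n --> \oo] --> fine (P (Y @^-1` `]y, +oo[)).
  move=> mY Y0.
  have -> : fine (P (Y @^-1` `]y, +oo[)) = \int[P]_x (ln 2 < w * Y x)%R%:R.
    rewrite /Rintegral -[X in P X]setIT -integral_indic//; last first.
      by rewrite -[X in measurable X]setTI; exact: mY.
    congr fine; apply: eq_integral => x _; rewrite indicE; congr (_%:R%:E).
    apply: congr1; rewrite /w mulrAC ltr_pdivlMr// ltr_pM2l; last first.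
      by rewrite ln_gt0// ltr1n.
    by apply/idP/idP; rewrite in_setE /= in_itv/= andbT.
  apply: (@cvg_Rintegral_bounded _ _ _ P _ _ 1).
  - move=> n; apply: measurable_funM; first exact: measurable_laplace.
    apply: measurable_funX; apply: measurable_funB => //.
    exact: measurable_laplace.
  - move=> n x; rewrite mul0r oppr0 expR0 mul1r.
    have /andP[? ?] := @laplace_itv R (n%:R * w) (Y x) (mulr_ge0 (ler0n _ _) w0) (Y0 x).
    rewrite ger0_norm ?exprn_ge0 ?subr_ge0//.
    by rewrite exprn_ile1 ?subr_ge0// gerBl.
  - move=> x; under eq_cvg do rewrite mul0r oppr0 expR0 mul1r.
    exact: cvg_laplace_indic.
have l1 := lim _ _ P1 Y1 mY1 Y1_ge0; have l2 := lim _ _ P2 Y2 mY2 Y2_ge0.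
have : fine (P1 (Y1 @^-1` `]y, +oo[)) = fine (P2 (Y2 @^-1` `]y, +oo[)).
  apply: cvg_unique l1 _ => //; apply: cvg_trans l2.
  apply: near_eq_cvg; near=> n; apply/esym.
  by apply: laplace_poly => //; rewrite mulr_ge0.
have mtail d (T : measurableType d) (Y : T -> R) : measurable_fun setT Y ->
    measurable (Y @^-1` `]y, +oo[).
  by move=> mY; rewrite -[X in measurable X]setTI; exact: mY.
move=> e12; rewrite -[LHS]fineK ?fin_num_measure//; last exact: mtail.
by rewrite e12 fineK// fin_num_measure//; exact: mtail.
Unshelve. all: by end_near. Qed.

Lemma probability_eq_ray (rho1 rho2 : probability R R) :
  (forall x, rho1 `]x, +oo[%classic = rho2 `]x, +oo[%classic) -> rho1 ≡μ rho2.
Proof.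
move=> r12 A mA.
apply: (@measure_unique _ _ _ (@RGenOInfty.G R) (fun k => `](- k%:R), +oo[%classic)) => //.
- exact: RGenOInfty.measurableE.
- move=> _ _ [x ->] [y ->]; exists (Num.max x y).
  apply/seteqP; split=> z /=; rewrite !in_itv/= !andbT gt_max; first by move=> [-> ->].
  by move/andP.
- by move=> k; exists (- k%:R).
- rewrite -subTset => x _; exists (Num.truncn `|x|).+1 => //=.
  rewrite in_itv /= andbT ltrNl (le_lt_trans (ler_norm _))// normrN.
  exact: truncnS_gt.
- by move=> _ [x ->]; exact: r12.
- by move=> k; rewrite -ge0_fin_numE// fin_num_measure.
Qed.

End laplace_transform.

(** * Laplace transforms along a complex ray *)

Section elementary_bounds.
Variable R : realType.
Implicit Types f g : R -> R.

Lemma le_of_derive_ge0 f g :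
  (forall x : R, is_derive x 1 f (g x)) -> (forall x, 0 <= x -> 0 <= g x) ->
  forall x, 0 <= x -> f 0 <= f x.
Proof.
move=> df g0 x x0; have [->|xn0] := eqVneq x 0; first by [].
have [|c /[!in_itv]/= /andP[c0 _] fx] := @MVT_segment R f g _ _ x0 (fun y _ => df y).
  apply: derivable_within_continuous => y _.
  exact: (@ex_derive _ _ _ _ _ _ _ (df y)).
by rewrite -subr_ge0 fx mulr_ge0 ?g0// subr_ge0.
Qed.


Lemma sin_le x : 0 <= x -> sin x <= x :> R.
Proof.
have df (y : R) : is_derive y 1 (fun x => x - sin x) (1 - cos y).
  exact: is_deriveB.
move=> x0; rewrite -subr_ge0.
have := le_of_derive_ge0 df _ x0.
rewrite sin0 subrr; apply.
by move=> y _; rewrite subr_ge0 cos_le1.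
Qed.

Lemma sin_geN x : 0 <= x -> - x <= sin x :> R.
Proof.
have df (y : R) : is_derive y 1 (fun x => sin x + x) (cos y + 1).
  exact: is_deriveD.
move=> x0; rewrite -subr_ge0 opprK.
have := le_of_derive_ge0 df _ x0.
rewrite sin0 addr0; apply.
by move=> y _; rewrite -lerBlDr sub0r cos_geN1.
Qed.

Lemma cos_ge_affine x : 0 <= x -> 1 - (x + x) <= cos x :> R.
Proof.
have df (y : R) : is_derive y 1 (fun x => x + x + cos x) (1 + 1 - sin y).
  have h : is_derive y 1 (fun x : R => x + x) (1 + 1) by exact: is_deriveD.
  exact: is_deriveD.
move=> x0; rewrite lerBlDr addrC.
have := le_of_derive_ge0 df _ x0.
rewrite !add0r cos0; apply => y _.
by have := sin_le1 y; lra.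
Qed.

Lemma sin_ge_quad x : 0 <= x -> x - x ^+ 2 <= sin x :> R.
Proof.
have df (y : R) : is_derive y 1 (fun x => sin x - x + x * x)
    (cos y - 1 + (y * 1 + y * 1)).
  have h : is_derive y 1 (fun x : R => x * x) (y * 1 + y * 1).
    have := @is_deriveM R _ id id y 1 1 1 _ _; rewrite /GRing.scale /=; exact.
  have h' : is_derive y 1 (fun x : R => sin x - x) (cos y - 1).
    exact: is_deriveB.
  exact: is_deriveD.
move=> x0; rewrite -subr_ge0.
have := le_of_derive_ge0 df _ x0.
rewrite sin0 subr0 mul0r addr0 => h.
rewrite (_ : _ - _ = sin x - x + x * x); last by ring.
by apply: h => y y0; have := cos_ge_affine y0; lra.
Qed.

(** Passing through [1/(1 + v)], this rests on [(1 + v)(1 - v + v^2) = 1 + v^3]. *)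
Lemma expRN_le_quad v : 0 <= v -> expR (- v) <= 1 - v + v ^+ 2 :> R.
Proof.
move=> v0; rewrite expRN; apply: (@le_trans _ _ (1 + v)^-1).
  by rewrite lef_pV2 ?posrE ?expR_gt0 ?expR_ge1Dx//; lra.
rewrite -[leLHS]div1r ler_pdivrMr; last lra.
have : 0 <= v ^+ 3 by rewrite exprn_ge0.
by nra.
Qed.

(** The second-order terms of the two functions cancel. With [v = t/2] the sum equals
    [4 (sinh^2 v - sin^2 v)], a product in which [sinh v - sin v] is at most [2 v^2 exp v] and
    [sinh v + sin v] at most [2 v exp v] in absolute value. *)
Lemma cosh_cos_bound t : 0 <= t ->
  `|expR t + expR (- t) + 2 * cos t - 4| <= 2 * t ^+ 3 * expR t :> R.
Proof.
move=> t0; pose v := t / 2.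
have v0 : 0 <= v by rewrite divr_ge0.
have -> : t = v + v by rewrite /v; lra.
pose S := (expR v - expR (- v)) / 2; pose s := sin v.
have ee : expR v * expR (- v) = 1 :> R by exact: expRxMexpNx_1.
have -> : expR (v + v) + expR (- (v + v)) + 2 * cos (v + v) - 4 =
    4 * ((S - s) * (S + s)).
  rewrite opprD !expRD cosD -!expr2 cos2sin2 -/s /S.
  move: ee; set a := expR v; set b := expR (- v) => ee.
  have -> : a ^+ 2 + b ^+ 2 = (a - b) ^+ 2 + 2 * (a * b) by ring.
  by rewrite ee; field.
have e1 : 1 + v <= expR v := expR_ge1Dx v.
have e2 : 1 - v <= expR (- v) := expR_ge1Dx (- v).
have e3 := expRN_le_quad v0.
have s1 : s <= v := sin_le v0.
have s2 : v - v ^+ 2 <= s := sin_ge_quad v0.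
have s3 : - v <= s := sin_geN v0.
have E1 : 1 <= expR v by lra.
have v2 : 0 <= v ^+ 2 by rewrite sqr_ge0.
have ve : v <= v * expR v by rewrite ler_peMr.
have v2e : v ^+ 2 <= v ^+ 2 * expR v by rewrite ler_peMr.
have S0 : 0 <= S.
  by rewrite /S divr_ge0// subr_ge0 ler_expR; lra.
have SU : S <= v * expR v.
  rewrite /S ler_pdivrMr//.
  have : expR v * (1 - v *+ 2) <= expR v * expR (- (v *+ 2)).
    by rewrite ler_wpM2l ?expR_ge0// expR_ge1Dx.
  by rewrite -expRD (_ : v + - (v *+ 2) = - v); [nra|ring].
have SL : v - v ^+ 2 <= S by rewrite /S; lra.
have Sms : `|S - s| <= 2 * (v ^+ 2 * expR v).
  rewrite ler_norml; apply/andP; split; first lra.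
  have : v * expR v - v <= v ^+ 2 * expR v; last lra.
  have : expR v * (1 - v) <= expR v * expR (- v) by rewrite ler_wpM2l ?expR_ge0.
  by rewrite ee; nra.
have Sps : `|S + s| <= 2 * (v * expR v).
  by rewrite ler_norml; apply/andP; split; lra.
rewrite !normrM ger0_norm//.
apply: (@le_trans _ _ (4 * (2 * (v ^+ 2 * expR v) * (2 * (v * expR v))))).
  by rewrite ler_wpM2l// ler_pM.
by rewrite expRD le_eqVlt; apply/predU1P; left; ring.
Qed.

End elementary_bounds.

(** The real part of [E exp(-(u + i v) Y)], harmonic for [u > 0]. The absolute value of [u] keeps
    the integrand bounded by 1 on the whole plane when [Y >= 0], so continuity holds everywhere and
    not only on a half-plane. *)
Definition laplace_re (R : realType) d (T : measurableType d)
    (P : probability T R) (Y : T -> R) (u v : R) : R :=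
  \int[P]_x (expR (- (`|u| * Y x)) * cos (v * Y x)).

(** * The real part of the Laplace transform in the half-plane *)

Section laplace_re.
Context (R : realType) d (T : measurableType d) (P : probability T R).
Variable Y : T -> R.
Hypothesis mY : measurable_fun setT Y.
Hypothesis Y_ge0 : forall x, 0 <= Y x.
Let G := laplace_re P Y.
Let g (u v : R) x : R := expR (- (`|u| * Y x)) * cos (v * Y x).

Lemma measurable_laplace_re u v : measurable_fun setT (g u v).
Proof.
apply: measurable_funM; first exact: measurable_laplace.
apply: measurableT_comp; last exact: measurable_funM.
exact: continuous_measurable_fun (@continuous_cos R).
Qed.

Lemma laplace_re_bound u v x : `|g u v x| <= 1.
Proof.
have /andP[h0 h1] := laplace_itv (normr_ge0 u) (Y_ge0 x).
by rewrite normrM ger0_norm// mulr_ile1// cos_max.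
Qed.

Lemma integrable_laplace_re u v : P.-integrable setT (EFin \o g u v).
Proof.
exact: bounded_integrable (measurable_laplace_re u v) (laplace_re_bound u v).
Qed.

Lemma laplace_re0 u : 0 <= u -> G u 0 = \int[P]_x expR (- (u * Y x)).
Proof.
move=> u0; apply: eq_Rintegral => x _.
by rewrite mul0r cos0 mulr1 ger0_norm.
Qed.

Lemma laplace_reN u v : G u (- v) = G u v.
Proof. by apply: eq_Rintegral => x _; rewrite mulNr cosN. Qed.

Lemma continuous_laplace_re (p : R * R) :
  {for p, continuous (fun q : R * R => G q.1 q.2)}.
Proof.
apply: seq_continuous => w wp.
apply: (@cvg_Rintegral_bounded _ _ _ P _ _ 1).
- by move=> n; exact: measurable_laplace_re.
- by move=> n x; exact: laplace_re_bound.
- move=> x.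
  have w1 : (w n).1 @[n --> \oo] --> p.1 by apply: cvg_comp wp _; exact: cvg_fst.
  have w2 : (w n).2 @[n --> \oo] --> p.2 by apply: cvg_comp wp _; exact: cvg_snd.
  apply: cvgM.
    apply: (cvg_comp _ (@expR R)); last exact: continuous_expR.
    by apply: cvgN; apply: cvgMl; exact: cvg_norm.
  apply: (cvg_comp _ (@cos R)); last exact: continuous_cos.
  exact: cvgMl.
Qed.

(** A quantitative form of harmonicity, without differentiation under the integral. The five-point
    sum of the integrand is an exact multiple of [exp(-u y) cos(v y)]: shifts in [u] contribute
    [exp(h y) + exp(-h y)], shifts in [v] contribute [2 cos(h y)], and [cosh_cos_bound] applies to
    the cofactor. *)
Lemma laplace_re_discrete_laplacian u v h : 0 < u -> 0 < h -> h <= u / 2 ->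
  `|G (u + h) v + G (u - h) v + G u (v + h) + G u (v - h) - 4 * G u v| <=
  96 / u ^+ 3 * h ^+ 3.
Proof.
move=> u0 h0 hu.
have i1 := integrable_laplace_re (u + h) v.
have i2 := integrable_laplace_re (u - h) v.
have i3 := integrable_laplace_re u (v + h).
have i4 := integrable_laplace_re u (v - h).
have i5 := integrable_laplace_re u v.
have i12 : P.-integrable setT (EFin \o (fun x => g (u + h) v x + g (u - h) v x)).
  exact: RintegrableD.
have i123 : P.-integrable setT (EFin \o (fun x => g (u + h) v x + g (u - h) v x + g u (v + h) x)).
  exact: RintegrableD.
have i1234 : P.-integrable setT (EFin \o
    (fun x => g (u + h) v x + g (u - h) v x + g u (v + h) x + g u (v - h) x)).
  exact: RintegrableD.
have i5' : P.-integrable setT (EFin \o (fun x => 4 * g u v x)).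
  exact: RintegrableZl.
rewrite /G /laplace_re -RintegralZl// -!RintegralD//= -RintegralB//.
apply: le_trans (le_normr_Rintegral _ _) _ => //; first exact: RintegrableB.
rewrite -[leRHS](Rintegral_cst1 P).
apply: le_Rintegral => //; first by apply: Rintegrable_norm; exact: RintegrableB.
  exact: finite_measure_integrable_cst.
move=> x _; set y := Y x; have y0 : 0 <= y := Y_ge0 x.
have n1 : `|u + h| = u + h by rewrite gtr0_norm; lra.
have n2 : `|u - h| = u - h by rewrite gtr0_norm; lra.
rewrite /g n1 n2 (gtr0_norm u0) -/y.
have -> : expR (- ((u + h) * y)) * cos (v * y) + expR (- ((u - h) * y)) * cos (v * y) +
    expR (- (u * y)) * cos ((v + h) * y) + expR (- (u * y)) * cos ((v - h) * y) -
    4 * (expR (- (u * y)) * cos (v * y)) =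
  expR (- (u * y)) * cos (v * y) *
    (expR (h * y) + expR (- (h * y)) + 2 * cos (h * y) - 4).
  rewrite !mulrDl cosD mulNr cosD sinN cosN !opprD opprK !expRD.
  by ring.
have hy0 : 0 <= h * y by rewrite mulr_ge0 // ltW.
rewrite !normrM (ger0_norm (expR_ge0 _)).
apply: (@le_trans _ _ (expR (- (u * y)) * 1 * (2 * (h * y) ^+ 3 * expR (h * y)))).
  by rewrite ler_pM ?mulr_ge0 ?expR_ge0 ?cosh_cos_bound// ler_pM ?expR_ge0 ?cos_max.
(* As [h <= u/2], the exponentials leave at most [exp(-z)], and [z^3/6 <= exp z] absorbs [y^3]: the
   constant is [2 * 6 * 2^3 = 96]. *)
pose z := u * y / 2.
have z0 : 0 <= z by rewrite /z divr_ge0// mulr_ge0// ltW.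
have zE : z ^+ 3 / 6 <= expR z.
  have := @expR_ge1Dxn R z 2 z0; rewrite (_ : 3`!%:R = 6 :> R)// => zE.
  by apply: le_trans zE; rewrite lerDr.
have ehz : expR (- (u * y)) * expR (h * y) <= expR (- z).
  by rewrite -expRD ler_expR /z; nra.
apply: (@le_trans _ _ (2 * (h * y) ^+ 3 * expR (- z))).
  rewrite mulr1 mulrCA ler_wpM2l// mulr_ge0// exprn_ge0//.
rewrite expRN ler_pdivrMr ?expR_gt0//.
apply: (@le_trans _ _ (96 / u ^+ 3 * h ^+ 3 * (z ^+ 3 / 6))).
  rewrite /z le_eqVlt; apply/predU1P; left; field.
  by rewrite gt_eqF.
rewrite ler_wpM2l// mulr_ge0 ?divr_ge0// exprn_ge0//; exact: ltW.
Qed.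

(** The event [Y = 0] is removed so that this tends to 0 as [u] grows. Nothing is lost: where
    [Y = 0] the integrand of [laplace_re] does not depend on [v], so differences in [v] see only
    [Y > 0]. *)
Definition laplace_tail_mass (u : R) : R :=
  \int[P]_x (expR (- (u * Y x)) * (0 < Y x)%R%:R).

Let measurable_ltm u : measurable_fun setT
  (fun x => expR (- (u * Y x)) * (0 < Y x)%R%:R : R).
Proof.
apply: measurable_funM; first exact: measurable_laplace.
have -> : (fun x => (0 < Y x)%R%:R : R) = \1_(Y @^-1` `]0, +oo[).
  apply/funext => x; rewrite indicE; congr (_%:R); apply: congr1.
  by apply/idP/idP; rewrite in_setE /= in_itv/= andbT.
by apply: measurable_indic; rewrite -[X in measurable X]setTI; exact: mY.
Qed.

Let ltm_bound u x : 0 <= u -> `|expR (- (u * Y x)) * (0 < Y x)%R%:R| <= 1 :> R.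
Proof.
move=> u0; have /andP[h0 h1] := laplace_itv u0 (Y_ge0 x).
by rewrite normrM ger0_norm// mulr_ile1//; case: (0 < _) => //=; rewrite ?normr1 ?normr0.
Qed.

Lemma cvg_laplace_tail_mass : laplace_tail_mass n%:R @[n --> \oo] --> 0.
Proof.
rewrite -[X in _ --> X](Rintegral_cst1 P).
apply: (@cvg_Rintegral_bounded _ _ _ P _ _ 1) => //.
  by move=> n x; exact: ltm_bound.
move=> x; have := Y_ge0 x; rewrite le_eqVlt => /predU1P[<-|Y0].
  by under eq_cvg do rewrite ltxx mulr0; exact: cvg_cst.
under eq_cvg do rewrite Y0 mulr1 -mulrN expRM_natl.
apply: cvg_expr; rewrite ger0_norm ?expR_ge0// expR_lt1.
by rewrite oppr_lt0.
Qed.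

Lemma laplace_re_diff u v v' : 0 <= u ->
  `|G u v - G u v'| <= 2 * laplace_tail_mass u.
Proof.
move=> u0.
have i1 := integrable_laplace_re u v.
have i2 := integrable_laplace_re u v'.
have i3 : P.-integrable setT (EFin \o (fun x => expR (- (u * Y x)) * (0 < Y x)%R%:R)).
  exact: bounded_integrable (measurable_ltm u) (fun x => ltm_bound x u0).
rewrite /G /laplace_re -RintegralB// -RintegralZl//.
apply: le_trans (le_normr_Rintegral _ _) _ => //; first exact: RintegrableB.
apply: le_Rintegral => //; first by apply: Rintegrable_norm; exact: RintegrableB.
  exact: RintegrableZl.
move=> x _; rewrite (ger0_norm u0) -mulrBr normrM ger0_norm ?expR_ge0//.
rewrite mulrCA ler_wpM2l ?expR_ge0//.
have := Y_ge0 x; rewrite le_eqVlt => /predU1P[<-|Y0].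
  by rewrite !mulr0 subrr normr0 ltxx mulr0.
rewrite Y0 mulr1 (le_trans (ler_normB _ _))//.
by have := cos_max (v * Y x); have := cos_max (v' * Y x); lra.
Qed.

End laplace_re.

(** * The maximum principle in a sector *)

Section laplace_ray.
Context (R : realType) d1 d2 (T1 : measurableType d1) (T2 : measurableType d2).
Variables (P1 : probability T1 R) (P2 : probability T2 R) (Y1 : T1 -> R) (Y2 : T2 -> R).
Hypothesis mY1 : measurable_fun setT Y1.
Hypothesis mY2 : measurable_fun setT Y2.
Hypothesis Y1_ge0 : forall x, 0 <= Y1 x.
Hypothesis Y2_ge0 : forall x, 0 <= Y2 x.
Variable k : R.
Hypothesis k_ge0 : 0 <= k.
Let D u v := laplace_re P1 Y1 u v - laplace_re P2 Y2 u v.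
Hypothesis D_ray : forall a, 0 <= a -> D a (k * a) = 0.

(** At a maximum of [x - y + q] the five-point Laplacian is at most 0. The part from [x - y] is at
    least [-2 B] and the part from [q] is [4 E], so [4 E <= 2 B <= 2 E]. *)
Let max_discrete_laplacian (x0 x1 x2 x3 x4 y0 y1 y2 y3 y4 q0 q1 q2 q3 q4 B E : R) :
  - B <= x1 + x2 + x3 + x4 - 4 * x0 -> y1 + y2 + y3 + y4 - 4 * y0 <= B ->
  x1 - y1 + q1 <= x0 - y0 + q0 -> x2 - y2 + q2 <= x0 - y0 + q0 ->
  x3 - y3 + q3 <= x0 - y0 + q0 -> x4 - y4 + q4 <= x0 - y0 + q0 ->
  q1 + q2 + q3 + q4 - 4 * q0 = 4 * E -> B <= E -> E <= 0.
Proof. lra. Qed.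

(* Maximum principle for [D + e (u^2 + v^2)] on the truncated sector
   [|v| <= k u], [u <= M]; the discrete Laplacian of [D] is [O(h^3)]. *)
Lemma laplace_ray_le u : 0 <= u -> D u 0 <= 0.
Proof.
move=> u0; rewrite leNgt; apply/negP => eta0.
have DN a b : D a (- b) = D a b by rewrite /D !laplace_reN.
have D_ray' a b : 0 <= a -> `|b| = k * a -> D a b = 0.
  by move=> a0; case: (ger0P b) => _ bE; [|rewrite -DN]; rewrite bE D_ray.
pose eta := D u 0.
pose W M := 2 * laplace_tail_mass P1 Y1 M + 2 * laplace_tail_mass P2 Y2 M.
have [M [uM M0 WM]] : exists M, [/\ u < M, 0 < M & W M < eta / 2].
  have W0 : W n%:R @[n --> \oo] --> 0.
    rewrite -[X in _ --> X]addr0; apply: cvgD;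
      rewrite -[X in _ --> X](mulr0 2); apply: cvgMr;
      exact: cvg_laplace_tail_mass.
  have eta2 : 0 < eta / 2 by rewrite divr_gt0.
  have /cvgr0Pnorm_lt/(_ _ eta2)[N _ NW] := W0.
  pose m := maxn N.+1 (Num.truncn u).+1; exists m%:R; split.
  - by rewrite (lt_le_trans (truncnS_gt _))// ler_nat leq_maxr.
  - by rewrite ltr0n leq_max.
  - apply: le_lt_trans (ler_norm _) _; apply: NW => /=.
    by rewrite leq_max leqnSn.
(* On the edge [u = M] the value of [D] is compared with its zero at [(M, k * M)], so the possible
   atoms of the two laws at 0 never have to be compared. *)
have DM b : `|D M b| < eta / 2.
  apply: le_lt_trans WM.
  have -> : D M b = (laplace_re P1 Y1 M b - laplace_re P1 Y1 M (k * M)) -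
      (laplace_re P2 Y2 M b - laplace_re P2 Y2 M (k * M)).
    have := D_ray (ltW M0); rewrite /D; lra.
  by rewrite (le_trans (ler_normB _ _))// lerD// laplace_re_diff// ltW.
(* On the truncated sector [u^2 + v^2 <= M^2 (1 + k^2)], so the perturbation is at most [eta/4].
   Then [F] stays below [eta/2 + eta/4] on the edge [u = M] and below [eta/4] on the rays, whereas
   [F (u, 0) >= eta]: the maximum is interior. *)
pose e := eta / (4 * (M ^+ 2 * (1 + k ^+ 2))).
have k2 : 0 < 1 + k ^+ 2 by rewrite ltr_wpDr ?sqr_ge0.
have e0 : 0 < e by rewrite divr_gt0// mulr_gt0// mulr_gt0// exprn_gt0.
pose F (p : R * R) := D p.1 p.2 + e * (p.1 ^+ 2 + p.2 ^+ 2).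
pose K := [set p : R * R | [/\ 0 <= p.1, p.1 <= M & `|p.2| <= k * p.1]].
have eK p : K p -> e * (p.1 ^+ 2 + p.2 ^+ 2) <= eta / 4.
  move=> [p10 p1M p2]; rewrite /e mulrAC ler_pdivrMr; last first.
    by rewrite mulr_gt0// mulr_gt0// exprn_gt0.
  rewrite -mulrA ler_wpM2l ?(ltW eta0)// [leRHS]mulrA mulVf ?mul1r//.
  rewrite mulrDr mulr1 lerD ?lerXn2r ?nnegrE// ?(ltW M0)//.
  rewrite -real_normK ?num_real// mulrC -exprMn lerXn2r ?nnegrE ?mulr_ge0 ?(ltW M0)//.
  by rewrite (le_trans p2)// ler_wpM2l.
have compK : compact K.
  apply: (@subclosed_compact _ _ (`[0, M]%classic `*` `[- (k * M), k * M]%classic)).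
  - have closed_le0 (f : R * R -> R) : continuous f -> closed [set p | f p <= 0].
      move=> cf; apply: (@closed_comp _ _ f [set y | y <= 0]); last exact: closed_le.
      by move=> p _; exact: cf.
    have -> : K = [set p : R * R | - p.1 <= 0] `&` [set p | p.1 - M <= 0] `&`
        [set p | `|p.2| - k * p.1 <= 0].
      apply/seteqP; split=> p; rewrite /K /= oppr_le0 !subr_le0; first by case.
      by case=> -[].
    apply: closedI; first apply: closedI; apply: closed_le0 => p.
    + by apply: cvgN; exact: cvg_fst.
    + by apply: cvgB; [exact: cvg_fst|exact: cvg_cst].
    + apply: cvgB; first by apply: cvg_norm; exact: cvg_snd.
      by apply: cvgMr; exact: cvg_fst.
  - by apply: compact_setX; exact: segment_compact.
  - move=> p [p10 p1M p2]; split; rewrite /= in_itv/= ?p10//.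
    by rewrite -ler_norml (le_trans p2)// ler_wpM2l.
have cF : {within K, continuous F}.
  apply: continuous_subspaceT => p.
  apply: cvgD; first by apply: cvgB; exact: continuous_laplace_re.
  by apply: cvgMr; apply: cvgD; apply: cvgM; (exact: cvg_fst || exact: cvg_snd).
have Ku : K (u, 0) by split => //=; [exact: ltW|rewrite normr0 mulr_ge0].
have [[a b] /set_mem Kab Fmax] := compact_EVT_max (ex_intro _ _ Ku) compK cF.
have {}Fmax p : K p -> F p <= F (a, b) by move=> /mem_set; exact: Fmax.
have Fu : eta <= F (a, b).
  apply: le_trans (Fmax _ Ku); rewrite /F/= -/eta lerDl mulr_ge0 ?(ltW e0)//.
  by rewrite addr_ge0 ?sqr_ge0.
have [/= a0 aM bka] := Kab.
have /= eab := eK _ Kab.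
have aM' : a < M.
  rewrite lt_neqAle aM andbT; apply/eqP => aE; move: Fu; rewrite /F/=.
  have := DM b; rewrite -aE ltr_norml => /andP[_].
  by move: eab eta0; rewrite -/eta; lra.
have bka' : `|b| < k * a.
  rewrite lt_neqAle bka andbT; apply/eqP => bE.
  by move: Fu; rewrite /F/= D_ray'//; move: eta0; rewrite -/eta; lra.
have a0' : 0 < a.
  rewrite lt_neqAle a0 andbT; apply/eqP => aE.
  by move: bka'; rewrite -aE mulr0 normr_lt0.
pose C := 96 / a ^+ 3.
have C0 : 0 < C by rewrite divr_gt0 ?exprn_gt0.
(* In order: [a / 2] for the bound on the discrete Laplacian, [M - a] to stay left of the edge,
   [(k + 1) h <= k a - |b|] to keep all four neighbours between the rays, and [C h <= e] to make the
   cubic error at most [e h^2]. *)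
pose h := Num.min (Num.min (a / 2) (M - a)) (Num.min ((k * a - `|b|) / (k + 1)) (e / C)).
have k1 : 0 < k + 1 by rewrite ltr_wpDl.
have h0 : 0 < h.
  have ek : 0 < e / C by rewrite divr_gt0.
  by rewrite !lt_min ek subr_gt0 aM' !divr_gt0// subr_gt0.
have [ha [hM [hk hC]]] : h <= a / 2 /\ h <= M - a /\
   h <= (k * a - `|b|) / (k + 1) /\ h <= e / C.
  by rewrite /h; split; [|split; [|split]]; rewrite !ge_min lexx ?orbT.
have hk' : k * h + h <= k * a - `|b| by move: hk; rewrite ler_pdivlMr//; lra.
have kh0 : 0 <= k * h by rewrite mulr_ge0 ?(ltW h0).
have L1 := laplace_re_discrete_laplacian P1 mY1 Y1_ge0 b a0' h0 ha.
have L2 := laplace_re_discrete_laplacian P2 mY2 Y2_ge0 b a0' h0 ha.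
have [ah1 ah2 ah3] : [/\ 0 <= a + h, 0 <= a - h & a - h <= M].
  by clear -a0' h0 ha hM; split; lra.
have kah : k * (a + h) = k * a + k * h by rewrite mulrDr.
have kah' : k * (a - h) = k * a - k * h by rewrite mulrBr.
have [b1 b2 b3] : [/\ `|b| <= k * (a + h), `|b| <= k * (a - h) & `|b| + h <= k * a].
  by rewrite kah kah'; clear -hk' kh0 h0; split; lra.
have K1 : K (a + h, b) by split=> //=; rewrite addrC -lerBrDr.
have K2 : K (a - h, b) by split.
have K3 : K (a, b + h).
  by split=> //=; apply: le_trans (ler_normD _ _) _; rewrite (gtr0_norm h0).
have K4 : K (a, b - h).
  by split=> //=; apply: le_trans (ler_normB _ _) _; rewrite (gtr0_norm h0).
move: (Fmax _ K1) (Fmax _ K2) (Fmax _ K3) (Fmax _ K4); rewrite /F/= => F1 F2 F3 F4.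
have hC' : 96 / a ^+ 3 * h ^+ 3 <= e * h ^+ 2.
  rewrite exprS mulrA ler_wpM2r ?sqr_ge0//.
  by rewrite mulrC -ler_pdivlMr.
have : 0 < e * h ^+ 2 by rewrite mulr_gt0// exprn_gt0.
apply/negP; rewrite -leNgt.
move: L1 L2; rewrite !ler_norml => /andP[L1 _] /andP[_ L2].
have qE : e * ((a + h) ^+ 2 + b ^+ 2) + e * ((a - h) ^+ 2 + b ^+ 2) +
  e * (a ^+ 2 + (b + h) ^+ 2) + e * (a ^+ 2 + (b - h) ^+ 2) -
  4 * (e * (a ^+ 2 + b ^+ 2)) = 4 * (e * h ^+ 2) by clear; ring.
exact: (max_discrete_laplacian L1 L2 F1 F2 F3 F4 qE hC').
Qed.

End laplace_ray.

Lemma laplace_ray_eq (R : realType) d1 d2 (T1 : measurableType d1) (T2 : measurableType d2)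
    (P1 : probability T1 R) (P2 : probability T2 R) (Y1 : T1 -> R) (Y2 : T2 -> R) (k : R) :
  measurable_fun setT Y1 -> measurable_fun setT Y2 ->
  (forall x, 0 <= Y1 x) -> (forall x, 0 <= Y2 x) ->
  (forall a, 0 <= a -> laplace_re P1 Y1 a (k * a) = laplace_re P2 Y2 a (k * a)) ->
  forall u, 0 <= u ->
    \int[P1]_x expR (- (u * Y1 x)) = \int[P2]_x expR (- (u * Y2 x)).
Proof.
move=> mY1 mY2 Y1_ge0 Y2_ge0 G12 u u0.
have {}G12 a : 0 <= a ->
    laplace_re P1 Y1 a (`|k| * a) = laplace_re P2 Y2 a (`|k| * a).
  case: (ger0P k) => _ /G12//.
  by rewrite mulNr !laplace_reN.
apply/eqP; rewrite -!laplace_re0// -subr_eq0 eq_le; apply/andP; split.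
  apply: (laplace_ray_le mY1 mY2 Y1_ge0 Y2_ge0 (normr_ge0 k)) => // a a0.
  by rewrite G12// subrr.
rewrite -oppr_le0 opprB.
apply: (laplace_ray_le mY2 mY1 Y2_ge0 Y1_ge0 (normr_ge0 k)) => // a a0.
by rewrite G12// subrr.
Qed.

(** * Bounded solutions of the cosine-sine addition formulas *)

Lemma ltr_natr_exp2 (R : realType) (n : nat) : n%:R < 2 ^+ n :> R.
Proof. by rewrite -(natrX R 2 n) ltr_nat ltn_expl. Qed.

(* Subtracting the chord through the end points, [a |-> 2 a] on [[0, delta/2]] and
   [a |-> delta - a] on [[delta/2, delta]] halve any bound. *)
Lemma bounded_additive_linear (R : realType) (delta B : R) (g : R -> R) :
  0 < delta ->
  (forall a b, 0 <= a -> 0 <= b -> a + b <= delta -> g (a + b) = g a + g b) ->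
  (forall a, 0 <= a <= delta -> `|g a| <= B) ->
  forall a, 0 <= a <= delta -> g a = a * (g delta / delta).
Proof.
move=> d0 gD gB a0 a0d; pose G a := g a - a * (g delta / delta).
have Gd : G delta = 0 by rewrite /G; field; rewrite gt_eqF.
have GD a b : 0 <= a -> 0 <= b -> a + b <= delta -> G (a + b) = G a + G b.
  by move=> ? ? ?; rewrite /G gD//; ring.
have half n a : 0 <= a <= delta -> `|G a| <= 2 * B / 2 ^+ n.
  elim: n a => [|n IH] a /andP[a_ge0 a_le].
    rewrite expr0 divr1 (le_trans (ler_normB _ _))// normrM (ger0_norm a_ge0).
    have := gB a; rewrite a_ge0 a_le => /(_ isT) ga.
    have := gB delta; rewrite ltW//= lexx => /(_ isT) gd.
    rewrite (_ : 2 * B = B + B); last by ring.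
    rewrite lerD// !normrM normfV (gtr0_norm d0).
    rewrite (le_trans _ gd)// mulrCA ler_piMr//.
    by rewrite ler_pdivrMr// mul1r.
  have hlf b : 0 <= b -> b + b <= delta -> `|G b| <= 2 * B / 2 ^+ n.+1.
    move=> b0 bd; have := IH (b + b); rewrite addr_ge0// bd => /(_ isT).
    rewrite GD// -mulr2n normrMn exprS invfM mulrCA.
    by rewrite ler_pdivlMl// [2 * `|_|]mulr_natl.
  have [aa|aa] := leP (a + a) delta; first exact: hlf.
  have -> : `|G a| = `|G (delta - a)|.
    have : G (a + (delta - a)) = G a + G (delta - a) by apply: GD; lra.
    rewrite addrCA subrr addr0 Gd => /esym/eqP; rewrite addr_eq0 => /eqP ->.
    by rewrite normrN.
  by apply: hlf; lra.
suff : G a0 = 0 by rewrite /G => /eqP; rewrite subr_eq0 => /eqP.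
apply/eqP; rewrite -normr_le0 leNgt; apply/negP => Ga0.
pose n := (Num.truncn (2 * B / `|G a0|)).+1.
have := half n _ a0d; apply/negP; rewrite -ltNge.
rewrite ltr_pdivrMr ?exprn_gt0// [ltRHS]mulrC -ltr_pdivrMr//.
exact: lt_trans (truncnS_gt _) (ltr_natr_exp2 _ _).
Qed.

Section trigonometric_pair.
Variables (R : realType) (delta : R) (c s : R -> R).
Hypothesis delta_gt0 : 0 < delta.
Hypothesis cD : forall a b, 0 <= a -> 0 <= b -> c (a + b) = c a * c b - s a * s b.
Hypothesis sD : forall a b, 0 <= a -> 0 <= b -> s (a + b) = s a * c b + c a * s b.
Hypothesis cs_le1 : forall a, 0 <= a -> c a ^+ 2 + s a ^+ 2 <= 1.
Hypothesis c_half : forall a, 0 <= a <= delta -> 1 / 2 <= c a.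

Let r a := Num.sqrt (c a ^+ 2 + s a ^+ 2).
Let theta a := atan (s a / c a).

Let polar a : 0 <= a <= delta ->
  [/\ 0 < r a, c a = r a * cos (theta a) & s a = r a * sin (theta a)].
Proof.
move=> ad; have c0 : 0 < c a by rewrite (lt_le_trans _ (c_half ad))//; lra.
have rho0 : 0 < c a ^+ 2 + s a ^+ 2 by rewrite ltr_pwDl ?sqr_ge0 ?exprn_gt0.
have r0 : 0 < r a by rewrite sqrtr_gt0.
have cE : c a = r a * cos (theta a).
  rewrite /theta cos_atan.
  have -> : 1 + (s a / c a) ^+ 2 = (c a ^+ 2 + s a ^+ 2) / (c a ^+ 2).
    by field; rewrite gt_eqF.
  rewrite sqrtrM ?(ltW rho0)// sqrtrV ?sqr_ge0// sqrtr_sqr (gtr0_norm c0) -/(r a).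
  by rewrite invfM invrK mulrA mulfV ?mul1r// gt_eqF.
split => //.
have ct : cos (theta a) != 0.
  by apply/eqP => ct0; move: c0; rewrite cE ct0 mulr0 ltxx.
have : tan (theta a) = s a / c a by rewrite atanK.
move=> /(congr1 ( *%R^~ (c a))); rewrite divfK ?gt_eqF// => <-.
by rewrite cE /tan mulrCA divfK.
Qed.

Let theta_itv a : - (pi / 2) < theta a < pi / 2.
Proof. by rewrite atan_gtNpi2 atan_ltpi2. Qed.

Let rD a b : 0 <= a -> 0 <= b -> r (a + b) = r a * r b.
Proof.
move=> a0 b0; rewrite /r -sqrtrM ?addr_ge0 ?sqr_ge0//; congr Num.sqrt.
by rewrite cD// sD//; ring.
Qed.

Let thetaD a b : 0 <= a -> 0 <= b -> a + b <= delta ->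
  theta (a + b) = theta a + theta b.
Proof.
move=> a0 b0 abd.
have ad : 0 <= a <= delta by rewrite a0/=; lra.
have bd : 0 <= b <= delta by rewrite b0/=; lra.
have abd' : 0 <= a + b <= delta by rewrite addr_ge0.
have [ra cA sA] := polar ad.
have [rb cB sB] := polar bd.
have [rab cAB sAB] := polar abd'.
set t := theta a + theta b.
have rn0 : r a * r b != 0 by rewrite mulf_neq0// gt_eqF.
have ct : cos t = cos (theta (a + b)).
  apply: (mulfI rn0); rewrite -{2}rD// -cAB cD// {1}cA {1}sA {1}cB {1}sB /t cosD; ring.
have st : sin t = sin (theta (a + b)).
  apply: (mulfI rn0); rewrite -{2}rD// -sAB sD// {1}cA {1}sA {1}cB {1}sB /t sinD; ring.
have /andP[u1 u2] := theta_itv a.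
have /andP[v1 v2] := theta_itv b.
(* Equal cosines and sines leave a multiple of [2 pi] open. Since [a + b <= delta], the cosine is
   positive, and together with [|t| <= pi] this confines [t] to the branch on which [atan] inverts
   [tan]. *)
have cpos : 0 < cos t by rewrite ct cos_gt0_pihalf// theta_itv.
have pi0 := pi_gt0 R.
have tpi : `|t| <= pi by rewrite ler_norml /t; lra.
have : `|t| < pi / 2.
  by rewrite -ltr_cos ?in_itv/= ?normr_ge0//; [rewrite cos_pihalf cos_norm|lra].
rewrite ltr_norml => tI.
by rewrite /theta -[RHS]tanK ?in_itv//= /tan st ct -/(tan _) atanK.
Qed.

(** In complex terms [f = c + i s] is multiplicative with [|f| <= 1]. On [[0, delta]] the bound
    [c >= 1/2] keeps the argument in one branch and the modulus above [1/2], so [theta] and [ln r]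
    are additive and bounded, hence linear; boundedness plays the part of continuity. Doubling the
    argument extends the formula to the half-line. *)
Lemma trigonometric_pair : exists x y : R, 0 <= x /\ forall a, 0 <= a ->
  c a = expR (- (x * a)) * cos (y * a) /\ s a = expR (- (x * a)) * sin (y * a).
Proof.
have d0d : 0 <= delta <= delta by rewrite lexx ltW.
have r_le1 a : 0 <= a -> r a <= 1.
  by move=> a0; rewrite -sqrtr1 ler_wsqrtr// cs_le1.
pose x := - (ln (r delta) / delta); pose y := theta delta / delta.
have x0 : 0 <= x.
  by rewrite oppr_ge0 mulr_le0_ge0 ?invr_ge0 ?ln_le0 ?r_le1// ltW.
have half n a : 0 <= a <= delta * 2 ^+ n ->
    c a = expR (- (x * a)) * cos (y * a) /\ s a = expR (- (x * a)) * sin (y * a).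
  elim: n a => [|n IH] a.
    rewrite expr0 mulr1 => ad; have [ra cA sA] := polar ad.
    have -> : expR (- (x * a)) = r a.
      have := @bounded_additive_linear _ _ (ln 2) (fun a => ln (r a)) delta_gt0 _ _ a ad.
      rewrite (_ : - (x * a) = a * (ln (r delta) / delta)); last by rewrite /x; ring.
      move=> <-; first by rewrite lnK.
      - move=> a' b' a'0 b'0 ab'; rewrite rD// lnM// posrE.
          by have [|] := @polar a' => //; rewrite a'0/=; lra.
        by have [|] := @polar b' => //; rewrite b'0/=; lra.
      - move=> b bd; have [rb _ _] := polar bd; have /andP[b0 _] := bd.
        rewrite ler0_norm ?ln_le0 ?r_le1// -lnV ?posrE// ler_ln ?posrE ?invr_gt0//.
        rewrite invf_ple ?posrE// -div1r (le_trans (c_half bd))//.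
        by have [_ -> _] := polar bd; rewrite ler_piMr ?(ltW rb)// cos_le1.
    have -> : y * a = theta a.
      have := @bounded_additive_linear _ _ (pi / 2) theta delta_gt0 thetaD _ a ad.
      rewrite /y [_ * a]mulrC => <- // b _; have /andP[? ?] := theta_itv b.
      by rewrite ler_norml !ltW.
    by split.
  move=> /andP[a0 an].
  have /IH[ch sh] : 0 <= a / 2 <= delta * 2 ^+ n.
    by rewrite divr_ge0//= ler_pdivrMr// -mulrA -exprSr.
  have -> : a = a / 2 + a / 2 by lra.
  have a20 : 0 <= a / 2 by rewrite divr_ge0.
  rewrite cD// sD// ch sh !mulrDr opprD expRD cosD sinD.
  by split; ring.
exists x, y; split => // a a0; apply: (half (Num.truncn (a / delta)).+1).
rewrite a0/= mulrC -ler_pdivrMr//.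
exact/ltW/(lt_trans (truncnS_gt _))/ltr_natr_exp2.
Qed.

End trigonometric_pair.

(** * Dilations, convolutions and scale mixtures *)

Section probability_laws.
Context (R : realType).

Lemma integral_probability_cst d (T : measurableType d) (P : probability T R) (r : \bar R) :
  (\int[P]_x r = r)%E.
Proof. by rewrite integral_cst//= probability_setT mule1. Qed.

Lemma distribution_ae_eq d d' (T : measurableType d) (T' : measurableType d')
    (P : probability T R) (X X' : {mfun T >-> T'}) :
  {ae P, forall w, X w = X' w} -> distribution P X ≡μ distribution P X'.
Proof.
move=> XX' A mA; rewrite -[A]setIT -!integral_indic//.
have mI : measurable_fun setT (EFin \o (\1_A : T' -> R)).
  by apply/measurable_EFinP; exact: measurable_indic.
have I0 y : (0 <= (EFin \o (\1_A : T' -> R)) y)%E by rewrite lee_fin.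
rewrite !(ge0_integral_distribution _ mI I0).
apply: ae_eq_integral => //; try exact: measurableT_comp.
by apply: filterS XX' => w /= -> _.
Qed.

(** Most identities between laws below are tested on nonnegative functions, where Tonelli applies
    without integrability conditions. *)
Lemma ge0_integral_eq_measure d (T : measurableType d) (mu nu : probability T R) :
  (forall f : T -> \bar R, measurable_fun setT f -> (forall x, 0 <= f x)%E ->
     (\int[mu]_x f x = \int[nu]_x f x)%E) -> mu ≡μ nu.
Proof.
move=> H A mA; rewrite -[A]setIT -!integral_indic//; apply: H => //.
by apply/measurable_EFinP; exact: measurable_indic.
Qed.

Lemma ae_eq_dirac d (T : measurableType d) (P : probability T R) (c : T) :
  {ae P, forall x, x = c} -> P ≡μ \d_c.
Proof.
move=> Pc.
have nc A : measurable A -> ~ A c -> P A = 0%E.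
  move=> mA Ac; apply: measure_negligible => //.
  case: Pc => N [mN N0 NS]; exists N; split => //.
  by apply: subset_trans NS => x Ax /= xc; apply: Ac; rewrite -xc.
move=> A mA; rewrite /= diracE; have [/set_mem Ac|/negP Ac] := boolP (c \in A); last first.
  by apply: nc => // /mem_set.
rewrite -[A]setCK probability_setC ?nc ?sube0//; first exact: measurableC.
exact: measurableC.
Qed.

End probability_laws.

Section vector_laws.
Context (R : realType) (n : nat).
Implicit Types (mu nu : probability 'rV[R]_n R) (f : 'rV[R]_n -> \bar R).

Lemma ge0_integral_convolve mu nu f :
  measurable_fun setT f -> (forall x, 0 <= f x)%E ->
  (\int[convolve mu nu]_z f z = \int[mu]_x \int[nu]_y f (x + y)%R)%E.
Proof.
move=> mf f0; rewrite /convolve ge0_integral_distribution//.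
by rewrite fubini_tonelli1//; [exact: measurableT_comp|move=> z; exact: f0].
Qed.

Lemma ge0_integral_dilate mu f r :
  measurable_fun setT f -> (forall x, 0 <= f x)%E ->
  (\int[dilate r mu]_z f z = \int[mu]_x f (r *: x)%R)%E.
Proof. by move=> mf f0; rewrite /dilate ge0_integral_distribution. Qed.

Lemma ge0_integral_scale_mixture mu (rho : probability R R) f :
  measurable_fun setT f -> (forall x, 0 <= f x)%E ->
  (\int[scale_mixture mu rho]_z f z = \int[rho]_t \int[mu]_x f (t *: x)%R)%E.
Proof.
move=> mf f0; rewrite /scale_mixture ge0_integral_distribution//.
by rewrite fubini_tonelli1//; [exact: measurableT_comp|move=> z; exact: f0].
Qed.

Lemma measurable_integral_snd d d' (T : measurableType d) (T' : measurableType d')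
    (P : probability T' R) (g : T * T' -> \bar R) :
  measurable_fun setT g -> (forall z, 0 <= g z)%E ->
  measurable_fun setT (fun x => \int[P]_y g (x, y))%E.
Proof. by move=> mg g0; exact: (@measurable_fun_fubini_tonelli_F _ _ _ _ _ P g). Qed.

Lemma measurable_scalev d (T : measurableType d) (Z : T -> R) (X : T -> 'rV[R]_n) :
  measurable_fun setT Z -> measurable_fun setT X ->
  measurable_fun setT (fun w => Z w *: X w).
Proof.
move=> mZ mX; have mp := measurable_fun_pair mZ mX.
exact: measurableT_comp (measurable_funPT (@Defs.scale_pair R n)) mp.
Qed.

Lemma measurable_addv d (T : measurableType d) (X Y : T -> 'rV[R]_n) :
  measurable_fun setT X -> measurable_fun setT Y ->
  measurable_fun setT (fun w => X w + Y w).
Proof.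
move=> mX mY; have mp := measurable_fun_pair mX mY.
exact: measurableT_comp (measurable_funPT (@Defs.add_pair R n)) mp.
Qed.

Lemma ge0_integral_mixture_distribution d (T : measurableType d) (P : probability T R)
    mu (Z : {mfun T >-> R}) f :
  measurable_fun setT f -> (forall x, 0 <= f x)%E ->
  (\int[scale_mixture mu (distribution P Z)]_z f z =
   \int[P]_w \int[mu]_x f (Z w *: x)%R)%E.
Proof.
move=> mf f0; rewrite ge0_integral_scale_mixture// ge0_integral_distribution//.
  apply: (@measurable_integral_snd _ _ _ _ mu (fun z : R * 'rV[R]_n => f (z.1 *: z.2))) => //.
  apply: measurableT_comp => //.
  by apply: measurable_scalev; [exact: measurable_fst|exact: measurable_snd].
by move=> t; apply: integral_ge0.
Qed.

Lemma convolve_congr mu mu' nu nu' :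
  mu ≡μ mu' -> nu ≡μ nu' -> convolve mu nu ≡μ convolve mu' nu'.
Proof.
move=> mm nn; apply: ge0_integral_eq_measure => f mf f0.
rewrite !ge0_integral_convolve//.
rewrite (eq_measure_integral mu'); last by move=> A mA _; exact: mm.
apply: eq_integral => x _.
by apply: eq_measure_integral => A mA _; exact: nn.
Qed.

Lemma scale_mixture_congr mu (rho rho' : probability R R) :
  rho ≡μ rho' -> scale_mixture mu rho ≡μ scale_mixture mu rho'.
Proof.
move=> rr; apply: ge0_integral_eq_measure => f mf f0.
rewrite !ge0_integral_scale_mixture//.
by apply: eq_measure_integral => A mA _; exact: rr.
Qed.

Lemma dilate_congr mu nu r : mu ≡μ nu -> dilate r mu ≡μ dilate r nu.
Proof.
move=> mn; apply: ge0_integral_eq_measure => f mf f0.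
rewrite !ge0_integral_dilate//.
by apply: eq_measure_integral => A mA _; exact: mn.
Qed.

Lemma dilate_dilate mu r s : dilate r (dilate s mu) ≡μ dilate (r * s) mu.
Proof.
apply: ge0_integral_eq_measure => f mf f0.
rewrite !ge0_integral_dilate//; last first.
  by apply: measurableT_comp => //; exact: measurable_scalev.
by apply: eq_integral => x _; rewrite scalerA.
Qed.

Lemma dilate_mixture mu (rho : probability R R) r :
  scale_mixture mu (dilate_real r rho) ≡μ dilate r (scale_mixture mu rho).
Proof.
apply: ge0_integral_eq_measure => f mf f0.
rewrite ge0_integral_dilate//.
rewrite [LHS](@ge0_integral_mixture_distribution _ _ rho mu (@Defs.scale_real R r) f mf f0).
have mfr : measurable_fun setT (fun x : 'rV[R]_n => f (r *: x)).
  by apply: measurableT_comp => //; exact: measurable_scalev.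
rewrite (ge0_integral_scale_mixture mu rho mfr (fun x => f0 _)).
by apply: eq_integral => t _; apply: eq_integral => x _; rewrite scalerA.
Qed.

(** Mixing scales may vanish, whereas stability is stated for positive ones. At scale 0 the dilated
    law is the point mass at the origin, neutral for convolution, and a zero scale drops out of the
    merged scale because [beta] is nonzero. *)
Lemma strictly_stable_ge0 mu (beta r s : R) : 0 < beta -> strictly_stable beta mu ->
  0 <= r -> 0 <= s ->
  convolve (dilate r mu) (dilate s mu) ≡μ
  dilate ((r `^ beta + s `^ beta) `^ beta^-1) mu.
Proof.
move=> b0 st r0 s0.
have b00 : beta != 0 by rewrite gt_eqF.
have powK t : 0 <= t -> (t `^ beta) `^ beta^-1 = t.
  by move=> t0; rewrite -powRrM mulfV// powRr1.
move: r0 s0; rewrite le_eqVlt => /predU1P[<-|r0].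
  move=> s0; apply: ge0_integral_eq_measure => f mf f0.
  rewrite ge0_integral_convolve// !ge0_integral_dilate//; last 2 first.
  - apply: (@measurable_integral_snd _ _ _ _ _
      (fun z : 'rV[R]_n * 'rV[R]_n => f (z.1 + z.2))) => //.
    apply: measurableT_comp => //.
    by apply: measurable_addv; [exact: measurable_fst|exact: measurable_snd].
  - by move=> x; exact: integral_ge0.
  rewrite powR0// add0r powK//.
  under eq_integral do under eq_integral do rewrite scale0r add0r.
  by rewrite integral_probability_cst ge0_integral_dilate.
rewrite le_eqVlt => /predU1P[<-|s0]; last exact: st.
apply: ge0_integral_eq_measure => f mf f0.
rewrite ge0_integral_convolve// !ge0_integral_dilate//; last 2 first.
- apply: (@measurable_integral_snd _ _ _ _ _ (fun z : 'rV[R]_n * 'rV[R]_n => f (z.1 + z.2))) => //.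
  apply: measurableT_comp => //.
  by apply: measurable_addv; [exact: measurable_fst|exact: measurable_snd].
- by move=> x; exact: integral_ge0.
rewrite powR0// addr0 powK ?(ltW r0)//.
apply: eq_integral => x _; rewrite ge0_integral_dilate//; last first.
  apply: measurableT_comp => //.
  by apply: measurable_addv => //; exact: measurable_cst.
under eq_integral do rewrite scale0r addr0.
by rewrite integral_probability_cst.
Qed.

Lemma mixture_convolve mu (beta : R) d1 d2 (T1 : measurableType d1)
    (T2 : measurableType d2) (P1 : probability T1 R) (P2 : probability T2 R)
    (Z1 : {mfun T1 >-> R}) (Z2 : {mfun T2 >-> R}) (V : {mfun (T1 * T2)%type >-> R}) :
  0 < beta -> strictly_stable beta mu ->
  (forall w, 0 <= Z1 w) -> (forall w, 0 <= Z2 w) ->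
  (forall w, V w = (Z1 w.1 `^ beta + Z2 w.2 `^ beta) `^ beta^-1) ->
  convolve (scale_mixture mu (distribution P1 Z1)) (scale_mixture mu (distribution P2 Z2)) ≡μ
  scale_mixture mu (distribution (P1 \x P2)%E V).
Proof.
move=> b0 st Z1_ge0 Z2_ge0 VE; apply: ge0_integral_eq_measure => f mf f0.
have mfadd : measurable_fun setT (fun z : 'rV[R]_n * 'rV[R]_n => f (z.1 + z.2)).
  apply: measurableT_comp => //.
  by apply: measurable_addv; [exact: measurable_fst|exact: measurable_snd].
have mfaddl (x : 'rV[R]_n) : measurable_fun setT (fun y : 'rV[R]_n => f (x + y)).
  apply: measurableT_comp => //.
  by apply: measurable_addv => //; exact: measurable_cst.
have mI nu : measurable_fun setT (fun x : 'rV[R]_n => \int[nu]_y f (x + y)%R)%E.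
  exact: (measurable_integral_snd nu mfadd (fun z => f0 _)).
have I0 nu x : (0 <= \int[nu]_y f (x + y)%R)%E by exact: integral_ge0.
rewrite (ge0_integral_convolve _ _ mf f0).
rewrite (ge0_integral_mixture_distribution P1 mu Z1 (mI _) (I0 _)).
rewrite (ge0_integral_mixture_distribution _ mu V mf f0).
have mJ : measurable_fun setT (fun w => \int[mu]_x f (V w *: x)%R)%E.
  apply: (@measurable_integral_snd _ _ _ _ mu
    (fun z : (T1 * T2) * 'rV[R]_n => f (V z.1 *: z.2))) => //.
  apply: measurableT_comp => //.
  by apply: measurable_scalev; [exact: measurableT_comp|exact: measurable_snd].
have J0 w : (0 <= \int[mu]_x f (V w *: x)%R)%E by exact: integral_ge0.
rewrite (fubini_tonelli1 _ mJ J0).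
apply: eq_integral => w1 _; rewrite /fubini_F.
transitivity (\int[mu]_x \int[P2]_w2 \int[mu]_y f (Z1 w1 *: x + Z2 w2 *: y)%R)%E.
  apply: eq_integral => x _.
  exact: (ge0_integral_mixture_distribution P2 mu Z2 (mfaddl _) (fun y => f0 _)).
(* The integrals come in the order [w1], [x], [w2], [y]. Exchanging [x] and [w2] brings the two
   copies of [mu] together under fixed scales, where stability applies. *)
have mK : measurable_fun setT
    (fun z : 'rV[R]_n * T2 => \int[mu]_y f (Z1 w1 *: z.1 + Z2 z.2 *: y)%R)%E.
  apply: (@measurable_integral_snd _ _ _ _ mu
    (fun z : ('rV[R]_n * T2) * 'rV[R]_n => f (Z1 w1 *: z.1.1 + Z2 z.1.2 *: z.2))) => //.
  apply: measurableT_comp => //; apply: measurable_addv; apply: measurable_scalev.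
  - exact: measurable_cst.
  - by apply: (measurableT_comp measurable_fst); exact: measurable_fst.
  - apply: measurableT_comp => //.
    by apply: (measurableT_comp measurable_snd); exact: measurable_fst.
  - exact: measurable_snd.
have K0 z : (0 <= \int[mu]_y f (Z1 w1 *: z.1 + Z2 z.2 *: y)%R)%E.
  exact: integral_ge0.
apply: etrans (fubini_tonelli _ mK K0) _.
apply: eq_integral => w2 _; rewrite /fubini_G /= VE/=.
rewrite -(ge0_integral_dilate _ _ mf f0).
rewrite -(eq_measure_integral _
  (fun A mA _ => strictly_stable_ge0 b0 st (Z1_ge0 w1) (Z2_ge0 w2) mA)).
rewrite (ge0_integral_convolve _ _ mf f0) (ge0_integral_dilate _ _ (mI _) (I0 _)).
apply: eq_integral => x _.
by rewrite (ge0_integral_dilate _ _ (mfaddl _) (fun y => f0 _)).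
Qed.

End vector_laws.

(** * Characteristic functions of strictly stable laws *)

Section characteristic_functions.
Context (R : realType) (n : nat).
Implicit Types (mu nu : probability 'rV[R]_n R).

(** With [sin_coord], the real and imaginary parts of the characteristic function of one
    coordinate. *)
Definition cos_coord mu (i : 'I_n) (s : R) : R := \int[mu]_z cos (s * z ord0 i).
Definition sin_coord mu (i : 'I_n) (s : R) : R := \int[mu]_z sin (s * z ord0 i).

Lemma measurable_cos (Z : 'rV[R]_n -> R) :
  measurable_fun setT Z -> measurable_fun setT (fun z => cos (Z z)).
Proof.
move=> mZ; apply: measurableT_comp mZ.
exact: continuous_measurable_fun (@continuous_cos R).
Qed.

Lemma measurable_sin (Z : 'rV[R]_n -> R) :
  measurable_fun setT Z -> measurable_fun setT (fun z => sin (Z z)).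
Proof.
move=> mZ; apply: measurableT_comp mZ.
exact: continuous_measurable_fun (@continuous_sin R).
Qed.

Let mscale i (s : R) : measurable_fun setT (fun z : 'rV[R]_n => s * z ord0 i).
Proof. by apply: measurable_funM => //; exact: measurable_coord. Qed.

Let mc i s := measurable_cos (mscale i s).
Let ms i s := measurable_sin (mscale i s).

Lemma cos_coord_dilate mu i r s : cos_coord (dilate r mu) i s = cos_coord mu i (s * r).
Proof.
rewrite /cos_coord /dilate (Rintegral_distribution _ _ (mc i s) (fun z => cos_max _)).
by apply: eq_Rintegral => z _; rewrite /= mxE mulrA.
Qed.

Lemma sin_coord_dilate mu i r s : sin_coord (dilate r mu) i s = sin_coord mu i (s * r).
Proof.
rewrite /sin_coord /dilate (Rintegral_distribution _ _ (ms i s) (fun z => sin_max _)).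
by apply: eq_Rintegral => z _; rewrite /= mxE mulrA.
Qed.

Let integrable_prod mu nu (f g : 'rV[R]_n -> R) :
  measurable_fun setT f -> measurable_fun setT g ->
  (forall z, `|f z| <= 1) -> (forall z, `|g z| <= 1) ->
  (mu \x nu)%E.-integrable setT (EFin \o (fun z => f z.1 * g z.2)).
Proof.
move=> mf mg f1 g1.
apply: (@bounded_integrable _ _ _ (mu \x nu)%E (fun z => f z.1 * g z.2) 1).
  by apply: measurable_funM; exact: measurableT_comp.
by move=> z; rewrite normrM mulr_ile1.
Qed.

Lemma cos_coord_convolve mu nu i s : cos_coord (convolve mu nu) i s =
  cos_coord mu i s * cos_coord nu i s - sin_coord mu i s * sin_coord nu i s.
Proof.
rewrite /cos_coord /convolve (Rintegral_distribution _ _ (mc i s) (fun z => cos_max _)).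
rewrite -!(@Rintegral_prodM _ _ _ _ _ _ _ _ _ 1)//; try by move=> z; rewrite ?cos_max ?sin_max.
have icc := integrable_prod mu nu (mc i s) (mc i s) (fun z => cos_max _) (fun z => cos_max _).
have iss := integrable_prod mu nu (ms i s) (ms i s) (fun z => sin_max _) (fun z => sin_max _).
rewrite -(RintegralB measurableT icc iss).
by apply: eq_Rintegral => z _; rewrite /= mxE mulrDr cosD.
Qed.

Lemma sin_coord_convolve mu nu i s : sin_coord (convolve mu nu) i s =
  sin_coord mu i s * cos_coord nu i s + cos_coord mu i s * sin_coord nu i s.
Proof.
rewrite /sin_coord /convolve (Rintegral_distribution _ _ (ms i s) (fun z => sin_max _)).
rewrite -!(@Rintegral_prodM _ _ _ _ _ _ _ _ _ 1)//; try by move=> z; rewrite ?cos_max ?sin_max.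
have isc := integrable_prod mu nu (ms i s) (mc i s) (fun z => sin_max _) (fun z => cos_max _).
have ics := integrable_prod mu nu (mc i s) (ms i s) (fun z => cos_max _) (fun z => sin_max _).
rewrite -(RintegralD measurableT isc ics).
by apply: eq_Rintegral => z _; rewrite /= mxE mulrDr sinD.
Qed.

(** This is [E |exp(i s X) - phi(s)|^2 = 1 - |phi(s)|^2] for a coordinate [X]. It gives both
    [|phi| <= 1] and, when [|phi(s)| = 1], that [exp(i s X)] is almost surely constant. *)
Lemma Rintegral_variance mu i s :
  \int[mu]_z ((cos (s * z ord0 i) - cos_coord mu i s) ^+ 2 +
              (sin (s * z ord0 i) - sin_coord mu i s) ^+ 2) =
  1 - (cos_coord mu i s ^+ 2 + sin_coord mu i s ^+ 2).
Proof.
set C := cos_coord mu i s; set S := sin_coord mu i s.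
have ic : mu.-integrable setT (EFin \o (fun z => cos (s * z ord0 i))).
  exact: bounded_integrable (mc i s) (fun z => cos_max _).
have is_ : mu.-integrable setT (EFin \o (fun z => sin (s * z ord0 i))).
  exact: bounded_integrable (ms i s) (fun z => sin_max _).
transitivity (\int[mu]_z (1 + (C ^+ 2 + S ^+ 2) -
    (2 * C * cos (s * z ord0 i) + 2 * S * sin (s * z ord0 i)))).
  have E (a b : R) : a ^+ 2 + b ^+ 2 = 1 -> (a - C) ^+ 2 + (b - S) ^+ 2 =
      1 + (C ^+ 2 + S ^+ 2) - (2 * C * a + 2 * S * b).
    by clearbody C S => h; lra.
  by apply: eq_Rintegral => z _; apply: E; exact: cos2Dsin2.
rewrite RintegralB//; last 2 first.
- exact: finite_measure_integrable_cst.
- by apply: RintegrableD; exact: RintegrableZl.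
rewrite Rintegral_cst1 RintegralD//; try exact: RintegrableZl.
rewrite !RintegralZl// -/(cos_coord mu i s) -/(sin_coord mu i s) -/C -/S.
ring.
Qed.

Lemma cos_sin_coord_le1 mu i s : cos_coord mu i s ^+ 2 + sin_coord mu i s ^+ 2 <= 1.
Proof.
rewrite -subr_ge0 -Rintegral_variance; apply: Rintegral_ge0 => z _.
by rewrite addr_ge0 ?sqr_ge0.
Qed.

Lemma cos_coord_near0 mu i : exists2 e : R, 0 < e &
  forall s, 0 <= s <= e -> 1 / 2 <= cos_coord mu i s.
Proof.
have c0 : cos_coord mu i 0 = 1.
  rewrite -[RHS](Rintegral_cst1 mu); apply: eq_Rintegral => z _.
  by rewrite mul0r cos0.
have := @continuity_under_integral R _ _ mu (fun s z => cos (s * z ord0 i)) setT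
  measurableT (-1) 1 _ _ (cst 1) _ _ 0.
move=> /(_ (fun s _ => bounded_integrable mu (mc i s) (fun z => cos_max _))).
have cont : {ae mu, forall y : 'rV[R]_n, setT y ->
    {in `]-1, 1[%classic, continuous (fun s : R => cos (s * y ord0 i))}}.
  apply: aeW => z _ s _; apply: (cvg_comp _ (@cos R)); last exact: continuous_cos.
  by apply: cvgMl; exact: cvg_id.
move=> /(_ cont (finite_measure_integrable_cst _ _ _)).
have ub s : `]-1, 1[%classic s ->
    {ae mu, forall y : 'rV[R]_n, setT y -> `|cos (s * y ord0 i)| <= (cst 1 : 'rV[R]_n -> R) y}.
  by move=> _; apply: aeW => z _; exact: cos_max.
move=> /(_ measurableT ub); rewrite inE/= in_itv/= => cc.
have half0 : 0 < 1 / 2 :> R by lra.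
have /cvgrPdist_lt /(_ _ half0)[e /= e0 eP] : (cos_coord mu i) s @[s --> 0] --> cos_coord mu i 0.
  by apply: cc; rewrite ltrN10 ltr01.
exists (e / 2); first by rewrite divr_gt0.
move=> s /andP[s0 se]; have := eP s; rewrite /= sub0r normrN ger0_norm// c0.
move=> /(_ _); have h : s < e by lra.
by move=> /(_ h); rewrite ltr_norml; lra.
Qed.

(** In the variable [a = s^alpha] stability says that the characteristic function is multiplicative
    in [a], so its two parts form a trigonometric pair. *)
Lemma stable_cos_coord mu (alpha : R) i : 0 < alpha -> strictly_stable alpha mu ->
  exists x y : R, 0 <= x /\ forall s, 0 <= s ->
  cos_coord mu i s = expR (- (x * s `^ alpha)) * cos (y * s `^ alpha) /\
  sin_coord mu i s = expR (- (x * s `^ alpha)) * sin (y * s `^ alpha).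
Proof.
move=> a0 st.
have an0 : alpha != 0 by rewrite gt_eqF.
have powK t : 0 <= t -> (t `^ alpha^-1) `^ alpha = t.
  by move=> t0; rewrite -powRrM mulVf// powRr1.
have powK' t : 0 <= t -> (t `^ alpha) `^ alpha^-1 = t.
  by move=> t0; rewrite -powRrM mulfV// powRr1.
pose c a := cos_coord mu i (a `^ alpha^-1).
pose s a := sin_coord mu i (a `^ alpha^-1).
have cE (a b : R) : 0 <= a -> 0 <= b -> forall f : probability 'rV[R]_n R -> R,
    (forall P Q : probability 'rV[R]_n R, P ≡μ Q -> f P = f Q) ->
    f (dilate ((a + b) `^ alpha^-1) mu) =
    f (convolve (dilate (a `^ alpha^-1) mu) (dilate (b `^ alpha^-1) mu)).
  move=> a_ge0 b_ge0 f fE; apply/esym/fE.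
  have := strictly_stable_ge0 a0 st (powR_ge0 a alpha^-1) (powR_ge0 b alpha^-1).
  by rewrite !powK.
have cD a b : 0 <= a -> 0 <= b -> c (a + b) = c a * c b - s a * s b.
  move=> a_ge0 b_ge0.
  have := cE a b a_ge0 b_ge0 (fun P => cos_coord P i 1)
    (fun P Q PQ => eq_Rintegral_measure _ PQ).
  by rewrite cos_coord_convolve !cos_coord_dilate !sin_coord_dilate !mul1r.
have sD a b : 0 <= a -> 0 <= b -> s (a + b) = s a * c b + c a * s b.
  move=> a_ge0 b_ge0.
  have := cE a b a_ge0 b_ge0 (fun P => sin_coord P i 1)
    (fun P Q PQ => eq_Rintegral_measure _ PQ).
  by rewrite sin_coord_convolve !cos_coord_dilate !sin_coord_dilate !mul1r.
have [e e0 eP] := cos_coord_near0 mu i.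
have [|a _|a /andP[a_ge0 ae]|x [y [x0 xy]]] :=
    @trigonometric_pair R (e `^ alpha) c s _ cD sD.
- exact: powR_gt0.
- exact: cos_sin_coord_le1.
- apply: eP; rewrite powR_ge0/= -[leRHS]powK' ?(ltW e0)//.
  by rewrite ge0_ler_powR ?invr_ge0 ?nnegrE ?powR_ge0 ?(ltW a0).
exists x, y; split => // t t0.
by have := xy (t `^ alpha) (powR_ge0 _ _); rewrite /c /s powK'.
Qed.

(** If [x = 0] for every coordinate, all characteristic functions have modulus 1 and each
    [exp(i s X)] is almost surely constant. The frequencies [1/(k+1)] are countable, so one null set
    serves them all, and small enough to tell any two points apart. *)
Lemma stable_nondegenerate mu (alpha : R) : 0 < alpha -> strictly_stable alpha mu ->
  ~ degenerate mu ->
  exists i (x y : R), 0 < x /\ forall s, 0 <= s ->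
  cos_coord mu i s = expR (- (x * s `^ alpha)) * cos (y * s `^ alpha).
Proof.
move=> a0 st nd; apply: contrapT => H; apply: nd.
have var0 i k : cos_coord mu i k.+1%:R^-1 ^+ 2 + sin_coord mu i k.+1%:R^-1 ^+ 2 = 1.
  have [x [y [x0 xy]]] := stable_cos_coord i a0 st.
  have xE : x = 0.
    apply/eqP; rewrite eq_le x0 andbT leNgt; apply/negP => xpos; apply: H.
    by exists i, x, y; split => // s /xy[].
  have [|-> ->] := xy k.+1%:R^-1; first by rewrite invr_ge0.
  by rewrite xE mul0r oppr0 expR0 !mul1r cos2Dsin2.
have aek i k : {ae mu, forall z : 'rV[R]_n,
    cos (k.+1%:R^-1 * z ord0 i) = cos_coord mu i k.+1%:R^-1 /\
    sin (k.+1%:R^-1 * z ord0 i) = sin_coord mu i k.+1%:R^-1}.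
  set t := k.+1%:R^-1.
  have V0 := Rintegral_variance mu i t; rewrite var0 subrr in V0.
  have mV : measurable_fun setT (fun z : 'rV[R]_n =>
      (cos (t * z ord0 i) - cos_coord mu i t) ^+ 2 +
      (sin (t * z ord0 i) - sin_coord mu i t) ^+ 2).
    by apply: measurable_funD; apply: measurable_funX; exact: measurable_funB.
  (* Both points lie on the unit circle, so the parallelogram law bounds their squared distance. *)
  have bnd (z : 'rV[R]_n) : 0 <= (cos (t * z ord0 i) - cos_coord mu i t) ^+ 2 +
      (sin (t * z ord0 i) - sin_coord mu i t) ^+ 2 <= 8.
    rewrite addr_ge0 ?sqr_ge0//=.
    have cs := cos2Dsin2 (t * z ord0 i).
    have := var0 i k; rewrite -/t => CS.
    have : 0 <= (cos (t * z ord0 i) + cos_coord mu i t) ^+ 2 +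
      (sin (t * z ord0 i) + sin_coord mu i t) ^+ 2 by rewrite addr_ge0 ?sqr_ge0.
    by nra.
  apply: filterS (Rintegral_eq0_ae mV bnd V0) => z /eqP.
  by rewrite paddr_eq0 ?sqr_ge0// !sqrf_eq0 !subr_eq0 => /andP[/eqP-> /eqP->].
have aeall : {ae mu, forall z : 'rV[R]_n, forall i k,
    cos (k.+1%:R^-1 * z ord0 i) = cos_coord mu i k.+1%:R^-1 /\
    sin (k.+1%:R^-1 * z ord0 i) = sin_coord mu i k.+1%:R^-1}.
  by apply: filter_forall => i; apply: ae_foralln => k; exact: aek.
have sep (z1 z2 : 'rV[R]_n) : (forall i k,
    cos (k.+1%:R^-1 * z1 ord0 i) = cos_coord mu i k.+1%:R^-1 /\
    sin (k.+1%:R^-1 * z1 ord0 i) = sin_coord mu i k.+1%:R^-1) -> (forall i k,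
    cos (k.+1%:R^-1 * z2 ord0 i) = cos_coord mu i k.+1%:R^-1 /\
    sin (k.+1%:R^-1 * z2 ord0 i) = sin_coord mu i k.+1%:R^-1) -> z1 = z2.
  move=> h1 h2; apply/rowP => i.
  set D := z1 ord0 i - z2 ord0 i.
  suff : `|D| = 0 by move=> /normr0_eq0/eqP; rewrite subr_eq0 => /eqP.
  (* This makes [|D|/(k+1) < 1 < pi], a range where the cosine is injective. *)
  pose k := Num.truncn `|D|.
  pose t : R := k.+1%:R^-1 * `|D|.
  have t1 : t < 1 by rewrite /t mulrC ltr_pdivrMr// mul1r truncnS_gt.
  have t0 : 0 <= t by rewrite mulr_ge0.
  have ct : cos t = cos 0.
    have -> : cos t = cos (k.+1%:R^-1 * D).
      by rewrite /t -[RHS]cos_norm normrM (@ger0_norm _ k.+1%:R^-1).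
    rewrite /D mulrBr cosB.
    have [-> ->] := h1 i k; have [-> ->] := h2 i k.
    by rewrite -!expr2 var0 cos0.
  have pi2 := pi_ge2 R.
  have : t = 0 by apply: cos_inj ct; rewrite in_itv/=; lra.
  by move/eqP; rewrite mulf_eq0 invr_eq0 pnatr_eq0/= => /eqP.
have [z0 z0P] : exists z0 : 'rV[R]_n, forall i k,
    cos (k.+1%:R^-1 * z0 ord0 i) = cos_coord mu i k.+1%:R^-1 /\
    sin (k.+1%:R^-1 * z0 ord0 i) = sin_coord mu i k.+1%:R^-1.
  have pf : ProperFilter (almost_everywhere mu).
    by apply: ae_properfilter_algebraOfSetsType; rewrite [ltRHS]probability_setT.
  exact: filter_ex aeall.
exists z0; apply: ae_eq_dirac; apply: filterS aeall => z zP.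
exact: sep.
Qed.

Lemma mixture_laplace mu (alpha : R) d1 d2 (T1 : measurableType d1)
    (T2 : measurableType d2) (P1 : probability T1 R) (P2 : probability T2 R)
    (Z1 : {mfun T1 >-> R}) (Z2 : {mfun T2 >-> R}) :
  0 < alpha -> strictly_stable alpha mu -> ~ degenerate mu ->
  (forall w, 0 <= Z1 w) -> (forall w, 0 <= Z2 w) ->
  scale_mixture mu (distribution P1 Z1) ≡μ scale_mixture mu (distribution P2 Z2) ->
  forall u, 0 <= u ->
    \int[P1]_w expR (- (u * Z1 w `^ alpha)) = \int[P2]_w expR (- (u * Z2 w `^ alpha)).
Proof.
move=> a0 st nd Z1_ge0 Z2_ge0 Z12.
have [i [x [y [x0 xy]]]] := stable_nondegenerate a0 st nd.
have mZ d (T : measurableType d) (Z : {mfun T >-> R}) :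
    measurable_fun setT (fun w => Z w `^ alpha).
  by apply: (measurableT_comp (measurable_powR _)).
have mixE d (T : measurableType d) (P : probability T R) (Z : {mfun T >-> R}) (s : R) :
    (forall w, 0 <= Z w) -> 0 <= s ->
    cos_coord (scale_mixture mu (distribution P Z)) i s =
    laplace_re P (fun w => Z w `^ alpha) (x * s `^ alpha) (y * s `^ alpha).
  move=> Z0 s0; rewrite /cos_coord /scale_mixture.
  rewrite (Rintegral_distribution _ _ (mc i s) (fun z => cos_max _)).
  have mf : measurable_fun setT (fun z : R * 'rV[R]_n => cos (s * (Defs.scale_pair z) ord0 i)).
    exact: (measurableT_comp (mc i s)).
  rewrite (@Rintegral_prod _ _ _ _ _ _ _ _ 1 mf); last by move=> z; exact: cos_max.
  have inner (t : R) : 0 <= t -> \int[mu]_z cos (s * (Defs.scale_pair (t, z)) ord0 i) =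
      expR (- (x * (s * t) `^ alpha)) * cos (y * (s * t) `^ alpha).
    move=> t0; rewrite -xy ?mulr_ge0//.
    by apply: eq_Rintegral => z _; rewrite /= mxE mulrA.
  rewrite (@Rintegral_distribution _ _ _ _ _ _ _ _ 1).
  - apply: eq_Rintegral => w _ /=; rewrite inner// powRM//.
    by rewrite (@ger0_norm _ (x * _)) ?mulr_ge0 ?powR_ge0 ?(ltW x0)// !mulrA.
  - exact: (measurable_Rintegral_snd mu mf (fun z => cos_max _)).
  - move=> t.
    have it : mu.-integrable setT (EFin \o (fun z => cos (s * (Defs.scale_pair (t, z)) ord0 i))).
      apply: (@bounded_integrable _ _ _ mu _ 1); last by move=> z; exact: cos_max.
      apply: (measurableT_comp mf).
      exact: measurable_fun_pair (measurable_cst t) (@measurable_id _ _ setT).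
    apply: le_trans (le_normr_Rintegral _ it) _ => //.
    rewrite -[leRHS](Rintegral_cst1 mu); apply: le_Rintegral => //.
    + exact: Rintegrable_norm.
    + exact: finite_measure_integrable_cst.
    + by move=> z _; exact: cos_max.
apply: (@laplace_ray_eq R _ _ _ _ P1 P2 _ _ (y / x)) => //.
- by move=> w; exact: powR_ge0.
- by move=> w; exact: powR_ge0.
(* The frequency is chosen with [x * s^alpha = a]; as [x > 0], every point of the ray of slope
   [y / x] is reached. *)
move=> a a_ge0; pose s := (a / x) `^ alpha^-1.
have sa : s `^ alpha = a / x.
  by rewrite /s -powRrM mulVf ?gt_eqF// powRr1// divr_ge0// ltW.
have -> : y / x * a = y * s `^ alpha by rewrite sa; ring.
have -> : a = x * s `^ alpha by rewrite sa mulrC divfK// gt_eqF.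
rewrite -!mixE//; try exact: powR_ge0.
exact: eq_Rintegral_measure.
Qed.

End characteristic_functions.

(** * Multiplicative scaling forces a power law *)

Lemma natmul_bounded_eq0 (R : realType) (x B : R) :
  (forall m : nat, m%:R * `|x| <= B) -> x = 0.
Proof.
move=> mB; apply/eqP; rewrite -normr_le0 leNgt; apply/negP => x0.
have := mB (Num.truncn (B / `|x|)).+1; apply/negP.
by rewrite -ltNge -ltr_pdivrMr// truncnS_gt.
Qed.

Lemma ler_lnX (R : realType) (x y : R) (i j : nat) : 0 < x -> 0 < y ->
  (i%:R * ln x <= j%:R * ln y) = (x ^+ i <= y ^+ j).
Proof. by move=> x0 y0; rewrite !mulr_natl -!lnXn// ler_ln// posrE exprn_gt0. Qed.

Section multiplicative_scaling.
Variables (R : realType) (L : R -> R).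
Hypothesis L_gt0 : forall t, 0 <= t -> 0 < L t.
Hypothesis L0 : L 0 = 1.
Hypothesis L_decr : forall t t', 0 <= t -> t < t' -> L t' < L t.
Hypothesis L_scale : forall r s, 0 <= r -> 0 <= s -> exists2 c, 0 <= c &
  forall u, 0 <= u -> L (r * u) * L (s * u) = L (c * u).

Let L1_lt1 : L 1 < 1. Proof. by rewrite -[ltRHS]L0; exact: L_decr. Qed.

Let Lle t t' : 0 <= t -> 0 <= t' -> (L t' <= L t) = (t <= t').
Proof.
move=> t0 t'0; case: (leP t t') => [|tt'].
  by rewrite le_eqVlt => /predU1P[->|/(L_decr t0)/ltW ->//]; rewrite lexx.
by apply/negbTE; rewrite -ltNge L_decr.
Qed.

Let power_scale k c := 0 <= c /\ forall u, 0 <= u -> L (c * u) = L u ^+ k.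

Let power_scale_exists k : exists c, power_scale k c.
Proof.
elim: k => [|k [c [c0 cP]]].
  by exists 0; split=> // u u0; rewrite mul0r L0 expr0.
have [d d0 dP] := L_scale ler01 c0.
by exists d; split=> // u u0; rewrite -dP// mul1r cP// exprS.
Qed.

Let power_scaleX k c j : power_scale k c -> power_scale (k ^ j) (c ^+ j).
Proof.
move=> [c0 cP]; elim: j => [|j [d0 dP]].
  by split=> // u u0; rewrite mul1r expr1.
split=> [|u u0]; first by rewrite exprn_ge0.
by rewrite exprS -mulrA cP ?mulr_ge0// dP// -exprM expnSr.
Qed.

Let power_scale_le k c m d : power_scale k c -> power_scale m d ->
  (c <= d) = (k <= m)%N.
Proof.
move=> [c0 cP] [d0 dP]; rewrite -Lle// -[c]mulr1 -[d]mulr1 cP// dP//.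
by rewrite ler_iXn2l// ?L_gt0.
Qed.

(** Dilating by [c] with [power_scale k c] raises [L] to the power [k]. As [L] is strictly
    decreasing, such scales are ordered like their exponents, and this order replaces continuity:
    logarithms are squeezed between consecutive multiples, with an error that stays bounded as the
    multiplier grows. *)
Lemma scaling_power : exists b p : R, [/\ 0 < b, 0 < p &
  forall t, 0 <= t -> L t = expR (- (b * t `^ p))].
Proof.
have ps1 : power_scale 1 1 by split=> // u u0; rewrite mul1r expr1.
have [c2 ps2] := power_scale_exists 2.
have c2_gt1 : 1 < c2 by rewrite ltNge (power_scale_le ps2 ps1).
have A0 : 0 < ln c2 by rewrite ln_gt0.
have B0 : 0 < ln 2 :> R by rewrite ln_gt0// ltr1n.
(* If [L t = exp(-b t^p)], then [c2^p = 2] and [L 1 = exp(-b)]; these equations fix [p] and [b]. *)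
pose p := ln 2 / ln c2; have p0 : 0 < p by rewrite divr_gt0.
pose b := - ln (L 1).
have L10 : 0 < L 1 by exact: L_gt0.
have b0 : 0 < b by rewrite oppr_gt0 ln_lt0// L10.
(* From [2^i <= k^j < 2^(i+1)] follows [c2^i <= c^j <= c2^(i+1)]. In logarithms, [j] times the
   difference is at most [ln c2 * ln 2], for every [j]. *)
have psE k c : (0 < k)%N -> power_scale k c -> c = k%:R `^ p^-1.
  move=> k0 psk.
  have c_ge1 : 1 <= c by rewrite (power_scale_le ps1 psk).
  have c0 : 0 < c by exact: lt_le_trans c_ge1.
  have kr0 : 0 < k%:R :> R by rewrite ltr0n.
  have E : ln c * ln 2 - ln k%:R * ln c2 = 0.
    apply: (@natmul_bounded_eq0 _ _ (ln c2 * ln 2)) => j.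
    have /andP[ij ji] := @trunc_log_bounds 2 (k ^ j) isT (ltac:(by rewrite expn_gt0 k0)).
    set i := trunc_log 2 (k ^ j) in ij ji.
    have psj := power_scaleX j psk.
    have h1 : c2 ^+ i <= c ^+ j by rewrite (power_scale_le (power_scaleX i ps2) psj).
    have h2 : c ^+ j <= c2 ^+ i.+1.
      by rewrite (power_scale_le psj (power_scaleX i.+1 ps2)) ltnW.
    have c20 : 0 < c2 by exact: lt_trans c2_gt1.
    have h3 : 2 ^+ i <= k%:R ^+ j :> R by rewrite -!natrX ler_nat.
    have h4 : k%:R ^+ j <= 2 ^+ i.+1 :> R by rewrite -!natrX ler_nat ltnW.
    rewrite -ler_lnX// in h1; rewrite -ler_lnX// -natr1 in h2.
    rewrite -ler_lnX// in h3; rewrite -ler_lnX// -natr1 in h4.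
    move: h1 h2 h3 h4.
    set x := ln c; set y := ln k%:R; set A := ln c2; set B := ln 2 => h1 h2 h3 h4.
    rewrite -[j%:R]ger0_norm// -normrM ler_norml.
    have g1 := ler_wpM2r (ltW B0) h1; have g2 := ler_wpM2r (ltW B0) h2.
    have g3 := ler_wpM2r (ltW A0) h3; have g4 := ler_wpM2r (ltW A0) h4.
    rewrite -/A -/B in g1 g2 g3 g4.
    by apply/andP; split; nra.
  have ck : ln c = p^-1 * ln k%:R.
    have : ln c * ln 2 = ln k%:R * ln c2 by apply/eqP; rewrite -subr_eq0 E.
    move=> h; rewrite /p invf_div mulrC mulrA -h mulfK// gt_eqF//.
  by rewrite -[LHS]lnK ?posrE// ck /powR gt_eqF.
exists b, p; split => // t t0.
have Lt0 := L_gt0 t0.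
suff : ln (L t) = - (b * t `^ p) by move=> <-; rewrite lnK.
have [->|tn0] := eqVneq t 0.
  by rewrite L0 ln1 powR0 ?gt_eqF// mulr0 oppr0.
have tgt0 : 0 < t by rewrite lt_neqAle eq_sym tn0.
apply/eqP; rewrite -subr_eq0 opprK addrC; apply/eqP.
have tp0 : 0 <= t `^ p by exact: powR_ge0.
have tpK : (t `^ p) `^ p^-1 = t by rewrite -powRrM mulfV ?gt_eqF// powRr1.
have pV0 : 0 <= p^-1 by rewrite invr_ge0 ltW.
apply: (@natmul_bounded_eq0 _ _ b) => -[|m].
  by rewrite mul0r ltW.
have [d psd] := power_scale_exists m.+1; have [d0 dP] := psd.
have dE := psE _ _ (ltn0Sn m) psd.
set M : R := m.+1%:R in dE *; have M0 : 0 <= M by rewrite ler0n.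
(* Monotonicity puts [d * t] between the scales of [k] and [k + 1], so [- M ln (L t)] lies between
   [k b] and [(k + 1) b], as does [M b t^p]. They differ by at most [b], whatever [M]. *)
pose k := Num.truncn (M * t `^ p).
have k1 : k%:R <= M * t `^ p by rewrite truncn_le// mulr_ge0.
have k2 : M * t `^ p < k.+1%:R by exact: truncnS_gt.
have dt : d * t = (M * t `^ p) `^ p^-1 by rewrite powRM// tpK dE.
have h1 : k%:R * b <= - (M * ln (L t)).
  have [k0|k0] := posnP k.
    rewrite k0 mul0r oppr_ge0 mulr_ge0_le0// ln_le0// -L0.
    by rewrite Lle.
  have [c psc] := power_scale_exists k; have [c0 cP] := psc.
  have cE := psE _ _ k0 psc.
  have : c <= d * t by rewrite dt cE ge0_ler_powR ?nnegrE ?mulr_ge0.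
  rewrite -Lle ?mulr_ge0// dP// -[c]mulr1 cP//.
  by rewrite -ler_lnX// -/M /b mulrN lerN2.
have h2 : - (M * ln (L t)) <= k.+1%:R * b.
  have [c psc] := power_scale_exists k.+1; have [c0 cP] := psc.
  have cE := psE _ _ (ltn0Sn k) psc.
  have : d * t <= c.
    by rewrite dt cE ge0_ler_powR ?nnegrE ?mulr_ge0 ?ler0n// ltW.
  rewrite -Lle ?mulr_ge0// dP// -[c]mulr1 cP//.
  by rewrite -ler_lnX// -/M /b mulrN lerN2.
rewrite -[M]ger0_norm// -normrM ler_norml.
have g1 := ler_wpM2r (ltW b0) k1; have g2 := ler_wpM2r (ltW b0) (ltW k2).
have kS : k.+1%:R = k%:R + 1 :> R by rewrite -natr1.
rewrite kS in h2 g2.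
by apply/andP; split; nra.
Qed.

Lemma scaling_power_le1 : (forall t, 0 <= t <= 1 -> t * (1 - L 1) <= 1 - L t) ->
  exists b p : R, [/\ 0 < b, 0 < p <= 1 &
  forall t, 0 <= t -> L t = expR (- (b * t `^ p))].
Proof.
move=> L_conc; have [b [p [b0 p0 LE]]] := scaling_power.
exists b, p; split => //; rewrite p0/= leNgt; apply/negP => p1.
have L1b : 1 - L 1 <= b.
  rewrite LE// powR1 mulr1; have := expR_ge1Dx (- b); lra.
have L1' : 0 < 1 - L 1 by rewrite subr_gt0.
(* With [t^(p-1) = q], the upper bound [1 - L t <= b t^p] is half of the chord bound [t (1 - L 1)],
   a contradiction; [q <= 1] keeps [t] in the unit interval because [p > 1]. *)
pose q := (1 - L 1) / (2 * b).
have q0 : 0 < q by rewrite divr_gt0// mulr_gt0.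
have q1 : q <= 1 by rewrite ler_pdivrMr ?mulr_gt0//; lra.
have p10 : 0 < p - 1 by rewrite subr_gt0.
pose t := q `^ (p - 1)^-1.
have t0 : 0 < t by exact: powR_gt0.
have t1 : t <= 1.
  have : t <= 1 `^ (p - 1)^-1.
    by rewrite ge0_ler_powR ?nnegrE ?invr_ge0 ?(ltW p10)// ltW.
  by rewrite powR1.
have tp : t `^ p = t * q.
  rewrite -(mulr_powRB1 (ltW t0) p0); congr (_ * _).
  by rewrite /t -powRrM mulVf ?gt_eqF// powRr1// ltW.
have := L_conc t; rewrite (ltW t0) t1 => /(_ isT).
rewrite [L t]LE ?(ltW t0)// tp.
have := expR_ge1Dx (- (b * (t * q))).
have -> : b * (t * q) = t * ((1 - L 1) / 2) by rewrite /q; field; rewrite gt_eqF.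
have : 0 < t * (1 - L 1) by rewrite mulr_gt0.
lra.
Qed.

End multiplicative_scaling.

(** * Laws on the half-line *)

Section laplace_of_law.
Context (R : realType).

(** No choice of [w] puts the threshold at 0, so this tail is the limit of the tails at
    [1/(k+1)]. *)
Lemma laplace_tail0 d1 d2 (T1 : measurableType d1) (T2 : measurableType d2)
    (P1 : probability T1 R) (P2 : probability T2 R) (Y1 : T1 -> R) (Y2 : T2 -> R) :
  measurable_fun setT Y1 -> measurable_fun setT Y2 ->
  (forall x, 0 <= Y1 x) -> (forall x, 0 <= Y2 x) ->
  (forall u, 0 <= u ->
    \int[P1]_x expR (- (u * Y1 x)) = \int[P2]_x expR (- (u * Y2 x))) ->
  P1 (Y1 @^-1` `]0, +oo[) = P2 (Y2 @^-1` `]0, +oo[).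
Proof.
move=> mY1 mY2 Y1_ge0 Y2_ge0 L12.
have lim d (T : measurableType d) (P : probability T R) (Y : T -> R) :
    measurable_fun setT Y -> (forall x : T, 0 <= Y x) ->
    P (Y @^-1` `]k.+1%:R^-1, +oo[) @[k --> \oo] --> P (Y @^-1` `]0, +oo[).
  move=> mY Y0.
  have mr r : measurable (Y @^-1` `]r, +oo[).
    by rewrite -[X in measurable X]setTI; exact: mY.
  have -> : Y @^-1` `]0, +oo[ = \bigcup_k (Y @^-1` `]k.+1%:R^-1, +oo[).
    apply/seteqP; split => [x|x [k _]] /=; rewrite !in_itv/= !andbT; last first.
      by apply: lt_trans; rewrite invr_gt0.
    move=> Yx; exists (Num.truncn (Y x)^-1) => //=; rewrite in_itv/= andbT.
    by rewrite invf_plt ?posrE// truncnS_gt.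
  apply: nondecreasing_cvg_mu => //; first exact: bigcup_measurable.
  move=> i j ij; apply/subsetPset => x /=; rewrite !in_itv/= !andbT.
  by apply: le_lt_trans; rewrite lef_pV2 ?posrE// ler_nat.
have l1 := lim _ _ P1 Y1 mY1 Y1_ge0; have l2 := lim _ _ P2 Y2 mY2 Y2_ge0.
apply: cvg_unique l1 _ => //; apply: cvg_trans l2.
apply: near_eq_cvg; near=> k; apply/esym.
by apply: laplace_tail => //; rewrite invr_gt0.
Unshelve. all: by end_near. Qed.

Lemma laplace_law d1 d2 (T1 : measurableType d1) (T2 : measurableType d2)
    (P1 : probability T1 R) (P2 : probability T2 R)
    (Z1 : {mfun T1 >-> R}) (Z2 : {mfun T2 >-> R}) (alpha : R) : 0 < alpha ->
  (forall w, 0 <= Z1 w) -> (forall w, 0 <= Z2 w) ->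
  (forall u, 0 <= u -> \int[P1]_w expR (- (u * Z1 w `^ alpha)) =
                       \int[P2]_w expR (- (u * Z2 w `^ alpha))) ->
  distribution P1 Z1 ≡μ distribution P2 Z2.
Proof.
move=> a0 Z1_ge0 Z2_ge0 L12; apply: probability_eq_ray => x.
have mZ d (T : measurableType d) (Z : {mfun T >-> R}) :
    measurable_fun setT (fun w => Z w `^ alpha).
  by apply: (measurableT_comp (measurable_powR _)).
suff : P1 (Z1 @^-1` `]x, +oo[) = P2 (Z2 @^-1` `]x, +oo[) by [].
have [x0|x0] := ltP x 0.
  have full d (T : measurableType d) (P : probability T R) (Z : T -> R) :
      (forall w, 0 <= Z w) -> P (Z @^-1` `]x, +oo[) = 1%E.
    move=> Z0; rewrite -(probability_setT P); congr (P _).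
    by apply/seteqP; split => // w _ /=; rewrite in_itv/= andbT (lt_le_trans x0).
  by rewrite (full _ _ P1 Z1 Z1_ge0) (full _ _ P2 Z2 Z2_ge0).
have tailE d (T : measurableType d) (Z : T -> R) : (forall w, 0 <= Z w) ->
    Z @^-1` `]x, +oo[ = (fun w => Z w `^ alpha) @^-1` `](x `^ alpha), +oo[.
  move=> Z0; apply/seteqP; split=> w /=; rewrite !in_itv/= !andbT.
    by move=> xw; rewrite gt0_ltr_powR ?nnegrE.
  rewrite ltNge => h; rewrite ltNge; apply: contra h => h.
  by rewrite ge0_ler_powR ?nnegrE// ltW.
rewrite (tailE _ _ Z1 Z1_ge0) (tailE _ _ Z2 Z2_ge0); move: x0; rewrite le_eqVlt => /predU1P[<-|x0].
  rewrite powR0 ?gt_eqF//.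
  by apply: laplace_tail0 => // w; exact: powR_ge0.
apply: laplace_tail => //; try by move=> w; exact: powR_ge0.
exact: powR_gt0.
Qed.

Context d (T : measurableType d) (P : probability T R).
Variable Y : T -> R.
Hypothesis mY : measurable_fun setT Y.
Hypothesis Y_ge0 : forall w, 0 <= Y w.
Let L u := \int[P]_w expR (- (u * Y w)).

Lemma laplace_bound u w : 0 <= u -> `|expR (- (u * Y w))| <= 1.
Proof.
by move=> u0; have /andP[h0 h1] := laplace_itv u0 (Y_ge0 w); rewrite ger0_norm.
Qed.

Lemma integrable_laplace u : 0 <= u ->
  P.-integrable setT (EFin \o (fun w => expR (- (u * Y w)))).
Proof.
move=> u0.
exact: bounded_integrable (measurable_laplace u mY) (fun w => laplace_bound w u0).
Qed.

Let proper_ae : ProperFilter (almost_everywhere P).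
Proof. by apply: ae_properfilter_algebraOfSetsType; rewrite [ltRHS]probability_setT. Qed.

Lemma laplace_gt0 u : 0 <= u -> 0 < L u.
Proof.
move=> u0; rewrite lt_neqAle Rintegral_ge0 ?andbT//.
apply/eqP => L0'; have L0 := esym L0'.
have h : forall w, 0 <= expR (- (u * Y w)) <= 1 by move=> w; exact: laplace_itv.
have aeL := Rintegral_eq0_ae (measurable_laplace u mY) h L0.
have [w /eqP] : exists w, expR (- (u * Y w)) = 0 by exact: filter_ex aeL.
by rewrite expR_eq0.
Qed.

Lemma laplace0 : L 0 = 1.
Proof.
rewrite -[RHS](Rintegral_cst1 P); apply: eq_Rintegral => w _.
by rewrite mul0r oppr0 expR0.
Qed.

Lemma laplace_decr : ~ {ae P, forall w, Y w = 0} ->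
  forall t t', 0 <= t -> t < t' -> L t' < L t.
Proof.
move=> Yn0 t t' t0 tt'; have t'0 : 0 <= t' by exact/ltW/(le_lt_trans t0).
rewrite -subr_gt0 /L -RintegralB//; [|exact: integrable_laplace|exact: integrable_laplace].
have h w : 0 <= expR (- (t * Y w)) - expR (- (t' * Y w)) <= 1.
  rewrite subr_ge0 ler_expR lerN2 ler_wpM2r// ?(ltW tt')//=.
  have /andP[_ h1] := laplace_itv t0 (Y_ge0 w).
  by rewrite lerBlDr (le_trans h1)// lerDl expR_ge0.
rewrite lt_neqAle Rintegral_ge0 ?andbT//; last by move=> w _; have /andP[] := h w.
apply/eqP => I0'; have I0 := esym I0'; apply: Yn0.
have mB : measurable_fun setT (fun w => expR (- (t * Y w)) - expR (- (t' * Y w))).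
  by apply: measurable_funB; exact: measurable_laplace.
apply: filterS (Rintegral_eq0_ae mB h I0) => w /eqP; rewrite subr_eq0 => /eqP/expR_inj.
move=> /oppr_inj/eqP; rewrite -subr_eq0 -mulrBl mulf_eq0 subr_eq0.
by rewrite (lt_eqF tt') => /eqP.
Qed.

Lemma laplace_concave t : 0 <= t <= 1 -> t * (1 - L 1) <= 1 - L t.
Proof.
move=> /andP[t0 t1].
have i1 := integrable_laplace ler01; have it := integrable_laplace t0.
have ic : P.-integrable setT (EFin \o (fun=> 1 : R)).
  exact: finite_measure_integrable_cst.
have c1 : 1 = \int[P]_w (1 : R) by rewrite Rintegral_cst1.
rewrite {1 3}c1 /L -!RintegralB// -RintegralZl//; last exact: RintegrableB.
apply: le_Rintegral => //.
- by apply: RintegrableZl; exact: RintegrableB.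
- exact: RintegrableB.
move=> w _; set y := Y w; have y0 : 0 <= y := Y_ge0 w.
rewrite mul1r.
(* The tangent of [exp] at [- (t y)] bounds it from below at [- y] and at [0]; with weights [t] and
   [1 - t] the linear terms cancel. *)
have e1 := expR_ge1Dx (- y + t * y); have e2 := expR_ge1Dx (t * y).
have E1 : expR (- y) = expR (- (t * y)) * expR (- y + t * y).
  by rewrite -expRD; congr expR; ring.
have E2 : 1 = expR (- (t * y)) * expR (t * y) by rewrite -expRD addNr expR0.
set E := expR (- (t * y)) in E1 E2 *.
have E0 : 0 <= E by exact: expR_ge0.
have g1 := ler_wpM2l E0 e1; have g2 := ler_wpM2l E0 e2.
rewrite -E1 in g1; rewrite -E2 in g2.
have : 0 <= t * (expR (- y) - E * (1 + (- y + t * y))).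
  by rewrite mulr_ge0// subr_ge0.
have : 0 <= (1 - t) * (1 - E * (1 + t * y)) by rewrite mulr_ge0 ?subr_ge0.
nra.
Qed.

(** An atom at 0 is a lower bound for every Laplace value. At [u = m^(1/p)] that value is
    [exp(-b m)], so [m P(Y = 0) <= 1/b] for all [m]. *)
Lemma laplace_power_gt0 (b p : R) : 0 < b -> 0 < p ->
  (forall u, 0 <= u -> L u = expR (- (b * u `^ p))) -> {ae P, forall w, 0 < Y w}.
Proof.
move=> b0 p0 LE.
pose A := Y @^-1` [set 0].
have mA : measurable A by rewrite /A -[X in measurable X]setTI; exact: mY.
have PA : fine (P A) = 0.
  apply: (@natmul_bounded_eq0 _ _ b^-1) => m.
  rewrite ger0_norm ?fine_ge0//.
  have mL : fine (P A) <= L (m%:R `^ p^-1).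
    have -> : fine (P A) = \int[P]_w (\1_A w).
      by rewrite /Rintegral integral_indic// setIT.
    apply: le_Rintegral => //.
    - apply: (@bounded_integrable _ _ _ P (\1_A) 1) => // w.
      by rewrite indicE; case: (_ \in _); rewrite ?normr1 ?normr0.
    - by apply: integrable_laplace; exact: powR_ge0.
    - move=> w _; rewrite indicE; have [/set_mem Aw|_] := boolP (w \in A).
        by rewrite (_ : Y w = 0)// mulr0 oppr0 expR0.
      exact: expR_ge0.
  move: mL; rewrite LE ?powR_ge0// -powRrM mulVf ?gt_eqF// powRr1// expRN => mL.
  have e1 := expR_ge1Dx (b * m%:R).
  have e0 := expR_gt0 (b * m%:R).
  rewrite -[leRHS]mul1r ler_pdivlMr//.
  have P0 : 0 <= fine (P A) by rewrite fine_ge0.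
  have : fine (P A) * expR (b * m%:R) <= 1 by rewrite -ler_pdivlMr// mul1r.
  have := ler_wpM2l P0 e1; nra.
exists A; split => //.
  by rewrite -[LHS]fineK ?fin_num_measure// PA.
move=> w /= Yw; rewrite /A/=; apply/eqP; rewrite eq_le Y_ge0 andbT leNgt.
exact/negP.
Qed.

(** The values of [L] at 1 and 2 give [exp(-Y)] mean [exp(-1)] and variance 0. *)
Lemma laplace_exp_cst : (forall u, 0 <= u -> L u = expR (- u)) -> {ae P, forall w, Y w = 1}.
Proof.
move=> LE; pose e : R := expR (- 1).
pose g w := (expR (- (1 * Y w)) - e) ^+ 2.
have ge1 : e <= 1 by rewrite expR_le1; lra.
have e0 : 0 <= e by exact: expR_ge0.
have mg : measurable_fun setT g.
  by apply: measurable_funX; apply: measurable_funB => //; exact: measurable_laplace.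
have hg w : 0 <= g w <= 1.
  rewrite /g sqr_ge0/= -real_normK ?num_real// expr_le1//.
  have /andP[h0 h1] := laplace_itv ler01 (Y_ge0 w).
  by rewrite ler_norml; lra.
have I0 : \int[P]_w g w = 0.
  transitivity (\int[P]_w (expR (- (2 * Y w)) - (2 * e * expR (- (1 * Y w)) - e ^+ 2))).
    apply: eq_Rintegral => w _; rewrite /g mul1r -mulrN expRM_natl; ring.
  have i1 := integrable_laplace ler01; have i2 := integrable_laplace (ler0n R 2).
  have ic : P.-integrable setT (EFin \o (fun=> e ^+ 2)).
    exact: finite_measure_integrable_cst.
  have i12 := RintegrableZl (2 * e) i1.
  rewrite RintegralB//; last exact: RintegrableB.
  rewrite RintegralB// RintegralZl// Rintegral_cst1.
  rewrite -/(L 2) -/(L 1) !LE// -/e (_ : - 2 = 2 * - 1); last by ring.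
  by rewrite expRM_natl -/e; ring.
apply: filterS (Rintegral_eq0_ae mg hg I0) => w /eqP.
by rewrite /g sqrf_eq0 subr_eq0 mul1r => /eqP/expR_inj/oppr_inj.
Qed.

End laplace_of_law.

(** * Weakly stable laws *)

Definition radial_sum (R : realType) T1 T2 (beta : R) (Z1 : T1 -> R) (Z2 : T2 -> R)
    (w : T1 * T2) : R :=
  (Z1 w.1 `^ beta + Z2 w.2 `^ beta) `^ beta^-1.

Section radial_sum.
Context (R : realType) d1 d2 (T1 : measurableType d1) (T2 : measurableType d2).
Variables (beta : R) (Z1 : {mfun T1 >-> R}) (Z2 : {mfun T2 >-> R}).

Let measurable_radial_sum : measurable_fun setT (radial_sum beta Z1 Z2).
Proof.
apply: (measurableT_comp (measurable_powR _)); apply: measurable_funD.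
  by apply: (measurableT_comp (measurable_powR _)); exact: measurableT_comp.
by apply: (measurableT_comp (measurable_powR _)); exact: measurableT_comp.
Qed.

HB.instance Definition _ :=
  isMeasurableFun.Build _ _ _ _ (radial_sum beta Z1 Z2) measurable_radial_sum.

Lemma laplace_radial_sum (P1 : probability T1 R) (P2 : probability T2 R) (u : R) :
  0 < beta -> 0 <= u ->
  \int[(P1 \x P2)%E]_w expR (- (u * radial_sum beta Z1 Z2 w `^ beta)) =
  \int[P1]_w expR (- (u * Z1 w `^ beta)) * \int[P2]_w expR (- (u * Z2 w `^ beta)).
Proof.
move=> b0 u0.
have mZ d (T : measurableType d) (Z : {mfun T >-> R}) :
    measurable_fun setT (fun w => Z w `^ beta).
  by apply: (measurableT_comp (measurable_powR _)).
rewrite -(@Rintegral_prodM _ _ _ _ _ P1 P2 _ _ 1).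
- apply: eq_Rintegral => w _.
  rewrite /radial_sum -powRrM mulVf ?gt_eqF// powRr1 ?addr_ge0 ?powR_ge0//.
  by rewrite mulrDr opprD expRD.
- exact: measurable_laplace.
- exact: measurable_laplace.
- by move=> w; apply: laplace_bound => // ?; exact: powR_ge0.
- by move=> w; apply: laplace_bound => // ?; exact: powR_ge0.
Qed.

End radial_sum.

Lemma measurable_rV1 (R : realType) n (x : 'rV[R]_n) : measurable [set x].
Proof.
rewrite (_ : [set x] =
    \bigcap_(i in [set: 'I_n]) ((fun z : 'rV[R]_n => z ord0 i) @^-1` [set x ord0 i])).
  apply: fin_bigcap_measurable => // i _.
  by rewrite -[X in measurable X]setTI; exact: measurable_coord.
apply/seteqP; split => z /=; first by move=> -> i _.
by move=> zx; apply/rowP => i; exact: zx.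
Qed.

(** If the mixture is the point mass at [x], then so is the law of [Z w *: X] for almost every [w];
    a single such [w] with [Z w > 0] concentrates [mu] at [x] divided by [Z w]. *)
Lemma mixture_nondegenerate (R : realType) n (mu : probability 'rV[R]_n R) d
    (T : measurableType d) (P : probability T R) (Z : {mfun T >-> R}) :
  {ae P, forall w, 0 < Z w} -> ~ degenerate mu ->
  ~ degenerate (scale_mixture mu (distribution P Z)).
Proof.
move=> Z0 nd [x mx]; apply: nd.
have mA : measurable (~` [set x]) by apply: measurableC; exact: measurable_rV1.
have g0 : scale_mixture mu (distribution P Z) (~` [set x]) = 0%E.
  by rewrite (mx _ mA) /= diracE memNset//; exact.
pose I : 'rV[R]_n -> \bar R := EFin \o \1_(~` [set x]).
have mI : measurable_fun setT I by apply/measurable_EFinP; exact: measurable_indic.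
have I0 y : (0 <= I y)%E by rewrite lee_fin.
pose J w := (\int[mu]_y I (Z w *: y))%E.
have mJ : measurable_fun setT J.
  apply: (@measurable_integral_snd _ _ _ _ _ mu (fun z : T * 'rV[R]_n => I (Z z.1 *: z.2))) => //.
  apply: measurableT_comp => //.
  by apply: measurable_scalev; [exact: measurableT_comp|exact: measurable_snd].
have J0 w : (0 <= J w)%E by exact: integral_ge0.
have intJ : (\int[P]_w `|J w| = 0)%E.
  rewrite -g0 -[X in scale_mixture _ _ X]setIT -integral_indic//.
  rewrite (ge0_integral_mixture_distribution P mu Z mI I0).
  by apply: eq_integral => w _; rewrite gee0_abs.
have aeJ : {ae P, forall w, 0 < Z w /\ J w = 0%E}.
  have /(ae_eq_integral_abs P measurableT mJ) h := intJ.
  by apply: filterS2 Z0 h => w Zw Jw; split=> //; exact: Jw.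
have [w [Zw Jw]] : exists w, 0 < Z w /\ J w = 0%E.
  have pf : ProperFilter (almost_everywhere P).
    by apply: ae_properfilter_algebraOfSetsType; rewrite [ltRHS]probability_setT.
  exact: filter_ex aeJ.
exists ((Z w)^-1 *: x); apply: ae_eq_dirac.
have mB : measurable (~` [set (Z w)^-1 *: x]) by apply: measurableC; exact: measurable_rV1.
exists (~` [set (Z w)^-1 *: x]); split => //.
rewrite -[X in mu X]setIT -integral_indic// -Jw; apply: eq_integral => y _.
rewrite /I /= !indicE !in_setC !in_set1; congr (_%:R%:E); congr (~~ _ : nat).
apply/eqP/eqP => [->|<-]; rewrite scalerA ?mulfV ?mulVf ?scale1r// gt_eqF//.
Qed.

(** * The three implications *)

Section stable_mixtures.
Context (R : realType) (n : nat) (alpha : R).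
Variables (gamma : probability 'rV[R]_n R) (lambda : probability R R).
Hypothesis alpha_gt0 : 0 < alpha.
Hypothesis gamma_stable : strictly_stable alpha gamma.
Hypothesis gamma_nondeg : ~ degenerate gamma.
Hypothesis lambda_ge0 : lambda `[0, +oo[%classic = 1%E.
Hypothesis lambda_neq0 : ~ (lambda ≡μ \d_(0 : R)).

Let powK t : 0 <= t -> (t `^ alpha^-1) `^ alpha = t.
Proof. by move=> t0; rewrite -powRrM mulVf ?gt_eqF// powRr1. Qed.
Let powK' t : 0 <= t -> (t `^ alpha) `^ alpha^-1 = t.
Proof. by move=> t0; rewrite -powRrM mulfV ?gt_eqF// powRr1. Qed.

Let ae_ge0 : {ae lambda, forall t, 0 <= t}.
Proof.
exists (~` `[0, +oo[%classic); split; first exact: measurableC.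
  by rewrite probability_setC// [X in (_ - X)%E]lambda_ge0 subee.
by move=> t /= t0; rewrite in_itv/= andbT.
Qed.

(* [scale_powR r 1] agrees with [scale_real r] on [[0, +oo[] and is nonnegative
   on the whole line. *)
Let dilate_powR r : dilate_real r lambda ≡μ distribution lambda (scale_powR r 1).
Proof.
apply: distribution_ae_eq; apply: filterS ae_ge0 => t t0.
by rewrite /= /scale_real /scale_powR powRr1.
Qed.

Let L (u : R) : R := \int[lambda]_t expR (- (u * t `^ alpha)).

Let laplace_scale_powR r u : 0 <= r ->
  \int[lambda]_t expR (- (u * (scale_powR r 1 t) `^ alpha)) = L (r `^ alpha * u).
Proof.
move=> r0; apply: eq_Rintegral => t _.
rewrite /scale_powR powRM ?powR_ge0// -powRrM mul1r; congr (expR (- _)); ring.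
Qed.

Lemma weakly_stable_laplace : weakly_strictly_stable gamma lambda ->
  forall r s, 0 <= r -> 0 <= s ->
  exists2 c, 0 <= c & forall u, 0 <= u -> L (r * u) * L (s * u) = L (c * u).
Proof.
move=> wst r s r0 s0.
(* A factor [r] on [Y = Z^alpha] is a factor [r^(1/alpha)] on [Z]. *)
have [c c0 cE] := wst _ _ (powR_ge0 r alpha^-1) (powR_ge0 s alpha^-1).
exists (c `^ alpha); first exact: powR_ge0.
set r' := r `^ alpha^-1 in cE; set s' := s `^ alpha^-1 in cE.
have r'0 : 0 <= r' by exact: powR_ge0.
have s'0 : 0 <= s' by exact: powR_ge0.
have Z0 (q : R) : 0 <= q -> forall t : R, 0 <= scale_powR q 1 t.
  by move=> q0 t; rewrite mulr_ge0 ?powR_ge0.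
have mixE : scale_mixture gamma (distribution (lambda \x lambda)%E
      (radial_sum alpha (scale_powR r' 1) (scale_powR s' 1))) ≡μ
    scale_mixture gamma (distribution lambda (scale_powR c 1)).
  move=> A mA.
  rewrite -(scale_mixture_congr gamma (dilate_powR c) mA) -(cE A mA).
  rewrite (convolve_congr (scale_mixture_congr gamma (dilate_powR r'))
    (scale_mixture_congr gamma (dilate_powR s')) mA).
  by rewrite -(mixture_convolve _ _ alpha_gt0 gamma_stable (Z0 _ r'0) (Z0 _ s'0)).
move=> u u0.
have V0 w : 0 <= radial_sum alpha (scale_powR r' 1) (scale_powR s' 1) w.
  exact: powR_ge0.
have := mixture_laplace alpha_gt0 gamma_stable gamma_nondeg V0 (Z0 _ c0) mixE u0.
rewrite (laplace_scale_powR _ c0) => <-.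
rewrite (@laplace_radial_sum _ _ _ _ _ alpha (scale_powR r' 1) (scale_powR s' 1)
  lambda lambda u alpha_gt0 u0).
have Er : \int[lambda]_t expR (- (u * scale_powR r' 1 t `^ alpha)) = L (r * u).
  by rewrite (laplace_scale_powR u r'0) /r' powK.
have Es : \int[lambda]_t expR (- (u * scale_powR s' 1 t `^ alpha)) = L (s * u).
  by rewrite (laplace_scale_powR u s'0) /s' powK.
exact: esym (congr2 *%R Er Es).
Qed.

Lemma weakly_stable_positive_stable : weakly_strictly_stable gamma lambda ->
  exists a p : R, [/\ 0 < a, 0 < p <= 1 &
    exists (d : measure_display) (T : measurableType d)
           (P : probability T R) (theta : {RV P >-> R}),
      positive_stable_rv p P theta /\
      lambda ≡μ distribution P (scale_powR a alpha^-1 \o theta)].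
Proof.
move=> wst.
have mY : measurable_fun setT (fun t : R => t `^ alpha) by exact: measurable_powR.
have Y0 (t : R) : 0 <= t `^ alpha by exact: powR_ge0.
have Yn0 : ~ {ae lambda, forall t, t `^ alpha = 0}.
  move=> h; apply: lambda_neq0; apply: ae_eq_dirac.
  by apply: filterS h => t /powR_eq0_eq0.
have [b [p [b0 p01 LE]]] := scaling_power_le1 (laplace_gt0 lambda mY Y0)
  (laplace0 lambda (fun t : R => t `^ alpha)) (laplace_decr mY Y0 Yn0) (weakly_stable_laplace wst)
  (laplace_concave lambda mY Y0).
have /andP[p0 p1] := p01.
(* As [b * beta^p = 1], the variable [theta = beta * t^alpha] has Laplace transform [exp(-u^p)]
   under [lambda]. The choice [a = beta^(-1/alpha)] then gives [a * theta^(1/alpha) = t] for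
   [t >= 0]. *)
pose beta := b `^ (- p^-1).
have beta0 : 0 < beta by exact: powR_gt0.
have betap : b * beta `^ p = 1.
  by rewrite /beta -powRrM mulNr mulVf ?gt_eqF// powRN powRr1 ?(ltW b0)// mulfV// gt_eqF.
exists (beta `^ (- alpha^-1)), p; split => //; first exact: powR_gt0.
exists _, R, lambda, (scale_powR beta alpha); split.
- have LE' u : 0 <= u -> \int[lambda]_t expR (- (u * scale_powR beta alpha t)) =
      expR (- u `^ p).
    move=> u0; rewrite -[u `^ p]mul1r -betap -mulrA -powRM ?(ltW beta0)//.
    rewrite -LE ?mulr_ge0 ?(ltW beta0)//; apply: eq_Rintegral => t _.
    by rewrite /scale_powR mulrCA mulrA.
  have Z0 (t : R) : 0 <= scale_powR beta alpha t by rewrite mulr_ge0// ltW.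
  split.
  + apply: filterS (laplace_power_gt0 mY Y0 b0 p0 LE) => t Yt.
    by rewrite mulr_gt0.
  + move=> _ t t0; rewrite unlock -LE'// EFin_Rintegral//.
    by apply: integrable_laplace.
  + move=> pE; apply: (@laplace_exp_cst _ _ _ lambda (scale_powR beta alpha)) => //.
    by move=> u u0; rewrite LE' // pE powRr1.
- move=> A mA; rewrite -[LHS](_ : distribution lambda (scale_real 1) A = _); last first.
    by congr (lambda _); apply/seteqP; split => t /=; rewrite /scale_real mul1r.
  apply: distribution_ae_eq => //; apply: filterS ae_ge0 => t t0.
  rewrite /= /scale_real /scale_powR powRM ?powR_ge0 ?(ltW beta0)// powK'//.
  by rewrite mul1r mulrA -powRD ?addNr ?powRr0 ?mul1r// (gt_eqF beta0) implybT.
Qed.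

Lemma positive_stable_mixture :
  (exists a p : R, [/\ 0 < a, 0 < p <= 1 &
    exists (d : measure_display) (T : measurableType d)
           (P : probability T R) (theta : {RV P >-> R}),
      positive_stable_rv p P theta /\
      lambda ≡μ distribution P (scale_powR a alpha^-1 \o theta)]) ->
  exists (a p : R) (gamma' : probability 'rV[R]_n R),
    [/\ 0 < a, 0 < p <= 1, strictly_stable (alpha * p) gamma',
        ~ degenerate gamma' & scale_mixture gamma lambda ≡μ dilate a gamma'].
Proof.
move=> [a [p [a0 p01 [d [T [P [theta [[th0 thL th1] lamE]]]]]]]].
have /andP[p0 p1] := p01.
pose Z (c : R) : {mfun T >-> R} := scale_powR c alpha^-1 \o theta.
have Z_ge0 c : 0 <= c -> forall w, 0 <= Z c w.
  by move=> c0 w; rewrite /= mulr_ge0 ?powR_ge0.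
have ZE c : 0 <= c -> {ae P, forall w, Z c w `^ alpha = c `^ alpha * theta w}.
  move=> c0; apply: filterS th0 => w thw.
  by rewrite /= /scale_powR powRM ?powR_ge0// powK// ltW.
have mZ c : measurable_fun setT (fun w => Z c w `^ alpha).
  by apply: (measurableT_comp (measurable_powR _)).
(* The cases [p < 1] and [p = 1] merge here into one formula, the only information on [theta] that
   the stability of [gamma'] requires besides its sign. *)
have ML c u : 0 <= c -> 0 <= u ->
    \int[P]_w expR (- (u * Z c w `^ alpha)) = expR (- (u `^ p * c `^ (alpha * p))).
  move=> c0 u0; have cu0 : 0 <= u * c `^ alpha by rewrite mulr_ge0 ?powR_ge0.
  transitivity (\int[P]_w expR (- ((u * c `^ alpha) * theta w))).
    apply: ae_eq_Rintegral; [exact: measurable_laplace|exact: measurable_laplace|].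
    by apply: filterS (ZE c c0) => w ->; rewrite mulrA.
  rewrite powRrM -powRM ?powR_ge0//.
  move: p1; rewrite le_eqVlt => /predU1P[pE|/thL th].
    rewrite pE powRr1// -[RHS](Rintegral_cst1 P).
    apply: ae_eq_Rintegral => //; first exact: measurable_laplace.
    by apply: filterS (th1 pE) => w ->; rewrite mulr1.
  by have := th _ cu0; rewrite unlock /Rintegral => ->.
pose gamma' := scale_mixture gamma (distribution P (Z 1)).
have dilE c : 0 <= c -> dilate c gamma' ≡μ scale_mixture gamma (distribution P (Z c)).
  move=> c0; apply: ge0_integral_eq_measure => f mf f0.
  have mfc : measurable_fun setT (fun x : 'rV[R]_n => f (c *: x)).
    by apply: measurableT_comp => //; exact: measurable_scalev.
  rewrite (ge0_integral_dilate _ _ mf f0).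
  rewrite (ge0_integral_mixture_distribution P gamma (Z 1) mfc (fun x => f0 _)).
  rewrite (ge0_integral_mixture_distribution P gamma (Z c) mf f0).
  apply: eq_integral => w _; apply: eq_integral => x _.
  by rewrite /= /scale_powR scalerA mul1r.
exists a, p, gamma'; split; [exact: a0|exact: p01| | |].
- move=> r s r0 s0 A mA.
  have ap0 : 0 < alpha * p by rewrite mulr_gt0.
  set c := _ `^ _; have c0 : 0 <= c by exact: powR_ge0.
  rewrite (dilE c c0 A mA) (convolve_congr (dilE r (ltW r0)) (dilE s (ltW s0)) mA).
  have Zr := Z_ge0 r (ltW r0); have Zs := Z_ge0 s (ltW s0).
  rewrite (@mixture_convolve _ _ _ _ _ _ _ _ _ _ _ _
    (radial_sum alpha (Z r) (Z s)) alpha_gt0 gamma_stable Zr Zs)//.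
  (* Only the laws of the scales remain to be compared. In the Laplace transform of the merged scale
     the exponents [r^(alpha p)] and [s^(alpha p)] add up, which is the transform for the scale
     [Z c]. *)
  apply: scale_mixture_congr mA.
  have V0 w : 0 <= radial_sum alpha (Z r) (Z s) w by exact: powR_ge0.
  apply: (@laplace_law _ _ _ _ _ (P \x P)%E P (radial_sum alpha (Z r) (Z s)) (Z c) alpha
    alpha_gt0 V0 (Z_ge0 c c0)) => u u0.
  rewrite (@laplace_radial_sum _ _ _ _ _ alpha (Z r) (Z s) P P u alpha_gt0 u0).
  apply: etrans (congr2 *%R (ML r u (ltW r0) u0) (ML s u (ltW s0) u0)) _.
  apply: etrans _ (esym (ML c u c0 u0)).
  rewrite -expRD -opprD -mulrDr; congr (expR (- (_ * _))).
  by rewrite /c -powRrM mulVf ?gt_eqF// powRr1// addr_ge0 ?powR_ge0.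
- apply: mixture_nondegenerate => //; apply: filterS th0 => w thw.
  by rewrite /= /scale_powR mul1r powR_gt0.
- move=> A mA; rewrite (dilE a (ltW a0) A mA).
  exact: (scale_mixture_congr gamma lamE mA).
Qed.

(** Dilating [lambda] dilates the mixture, so the condition on [lambda] becomes the stability of
    [gamma'] at the scales [a r] and [a s], and [c] is read off by homogeneity. *)
Lemma stable_mixture_weakly_stable :
  (exists (a p : R) (gamma' : probability 'rV[R]_n R),
    [/\ 0 < a, 0 < p <= 1, strictly_stable (alpha * p) gamma',
        ~ degenerate gamma' & scale_mixture gamma lambda ≡μ dilate a gamma']) ->
  weakly_strictly_stable gamma lambda.
Proof.
move=> [a [p [gamma' [a0 /andP[p0 _] st _ mixE]]]] r s r0 s0.
have ap0 : 0 < alpha * p by rewrite mulr_gt0.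
pose c := (r `^ (alpha * p) + s `^ (alpha * p)) `^ (alpha * p)^-1.
exists c; first exact: powR_ge0.
have dilE t : scale_mixture gamma (dilate_real t lambda) ≡μ dilate (a * t) gamma'.
  move=> A mA; rewrite (dilate_mixture gamma lambda t mA) (dilate_congr t mixE mA).
  by rewrite (dilate_dilate gamma' t a mA) mulrC.
move=> A mA; rewrite (convolve_congr (dilE r) (dilE s) mA) (dilE c A mA).
have -> : a * c = ((a * r) `^ (alpha * p) + (a * s) `^ (alpha * p)) `^ (alpha * p)^-1.
  rewrite !powRM ?(ltW a0)// -mulrDr powRM ?powR_ge0 ?addr_ge0 ?powR_ge0//.
  by rewrite -powRrM mulfV ?gt_eqF// powRr1// ltW.
by apply: (strictly_stable_ge0 ap0 st) mA; rewrite mulr_ge0// ltW.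
Qed.

End stable_mixtures.

Theorem theorem3 (R : realType) (n : nat) (alpha : R)
    (gamma : probability 'rV[R]_n R) (lambda : probability R R)
    (alpha_gt0 : 0 < alpha) (alpha_le2 : alpha <= 2)
    (gamma_stable : strictly_stable alpha gamma)
    (gamma_nondeg : ~ degenerate gamma)
    (lambda_ge0 : lambda `[0, +oo[%classic = 1%E)
    (lambda_neq0 : ~ (lambda ≡μ \d_(0 : R))) :
  [<-> weakly_strictly_stable gamma lambda;
       exists a p : R, [/\ 0 < a, 0 < p <= 1 &
         exists (d : measure_display) (T : measurableType d)
                (P : probability T R) (theta : {RV P >-> R}),
           positive_stable_rv p P theta /\
           lambda ≡μ distribution P (scale_powR a alpha^-1 \o theta)];
       exists (a p : R) (gamma' : probability 'rV[R]_n R),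
         [/\ 0 < a, 0 < p <= 1, strictly_stable (alpha * p) gamma',
             ~ degenerate gamma' &
             scale_mixture gamma lambda ≡μ dilate a gamma']].
Proof.
tfae.
- exact: weakly_stable_positive_stable.
- exact: positive_stable_mixture.
- exact: stable_mixture_weakly_stable.
Qed.
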